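(* The problem Path-Contractibility has a kernel with at most $5k+3$ vertices: there is a polynomial-time algorithm that, given an instance $(G,k)$, outputs an instance $(G',k')$ of Path-Contractibility such that $G'$ has at most $5k+3$ vertices and $(G,k)$ is a yes-instance if and only if $(G',k')$ is a yes-instance.
   Context: All graphs are finite, undirected and simple. Contracting an edge $xy$ removes $x$ and $y$ and replaces them by a new vertex adjacent to exactly the vertices that were adjacent to at least one of $x,y$. A graph $G$ is $k$-contractible to a graph $H$ if $H$ can be obtained from $G$ by at most $k$ edge contractions. Path-Contractibility: given a (connected) graph $G$ and an integer $k$ (the parameter), decide whether $G$ is $k$-contractible to a path. *)

(* Defs.v *)
From mathcomp Require Import all_boot.

Set Implicit Arguments.
Unset Strict Implicit.
Unset Printing Implicit Defensive.

Record sgraph := SGraph {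
  svertex :> finType;
  sedge : rel svertex;
  sedge_sym : symmetric sedge;
  sedge_irr : irreflexive sedge }.

(* The null graph is not connected. *)
Definition connected_graph (G : sgraph) : Prop :=
  0 < #|G| /\ forall x y : G, connect (@sedge G) x y.

Definition isomorphic (G H : sgraph) : Prop :=
  exists2 f : G -> H, bijective f & forall x y : G, sedge (f x) (f y) = sedge x y.

(* [None] is the new vertex that replaces [x] and [y]. *)
Section Contraction.
Variables (G : sgraph) (x y : G).

Definition contract_vertex : finType :=
  option {z : G | (z != x) && (z != y)}.

Definition contract_edge : rel contract_vertex := fun u v =>
  match u, v with
  | None, None => false
  | None, Some w => sedge x (val w) || sedge y (val w)
  | Some w, None => sedge x (val w) || sedge y (val w)
  | Some w, Some z => sedge (val w) (val z)
  end.

Fact contract_edge_sym : symmetric contract_edge.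
Proof. by move=> [u|] [v|] //=; rewrite sedge_sym. Qed.

Fact contract_edge_irr : irreflexive contract_edge.
Proof. by move=> [u|] //=; rewrite sedge_irr. Qed.

Definition contract : sgraph := SGraph contract_edge_sym contract_edge_irr.
End Contraction.

Inductive contracts_in : nat -> sgraph -> sgraph -> Prop :=
| contracts_in0 (G H : sgraph) : isomorphic G H -> contracts_in 0 G H
| contracts_inS m (G : sgraph) (x y : G) (H : sgraph) :
    sedge x y -> contracts_in m (contract x y) H -> contracts_in m.+1 G H.

Definition k_contractible (k : nat) (G H : sgraph) : Prop :=
  exists2 m, m <= k & contracts_in m G H.

Section PathGraph.
Variable n : nat.

Definition path_edge : rel 'I_n := fun i j => (i.+1 == j) || (j.+1 == i).

Fact path_edge_sym : symmetric path_edge.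
Proof. by move=> i j; rewrite /path_edge orbC. Qed.

Fact path_edge_irr : irreflexive path_edge.
Proof.
move=> i; rewrite /path_edge orbb; apply/negbTE; by rewrite neq_ltn ltnSn orbT.
Qed.

Definition path_graph : sgraph := SGraph path_edge_sym path_edge_irr.
End PathGraph.

(* A path has at least one vertex. *)
Definition contractible_to_path (k : nat) (G : sgraph) : Prop :=
  exists n, k_contractible k G (path_graph n.+1).

Record instance := Instance {
  nverts : nat;
  adj : rel 'I_nverts;
  adj_sym : symmetric adj;
  adj_irr : irreflexive adj;
  param : nat }.

Definition graph_of (I : instance) : sgraph := SGraph (@adj_sym I) (@adj_irr I).

Definition yes_instance (I : instance) : Prop :=
  contractible_to_path (param I) (graph_of I).

(* Binary digits, least significant first; 0 is the empty string. *)
Fixpoint bits_of_pos (p : BinNums.positive) : seq bool :=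
  match p with
  | BinNums.xH => [:: true]
  | BinNums.xO q => false :: bits_of_pos q
  | BinNums.xI q => true :: bits_of_pos q
  end.

Definition bits_of_nat (n : nat) : seq bool :=
  match bin_of_nat n with
  | BinNums.N0 => [::]
  | BinNums.Npos p => bits_of_pos p
  end.

(* 1^n 0, then the n * n adjacency matrix row by row, then k in binary. *)
Definition encode (I : instance) : seq bool :=
  nseq (nverts I) true ++ false ::
  [seq adj i j | i <- enum 'I_(nverts I), j <- enum 'I_(nverts I)] ++
  bits_of_nat (param I).

(* Deterministic multitape Turing machines over the alphabet {0, 1, blank},  *)
(* [None] being the blank.                                                   *)
Definition symbol := option bool.

Inductive direction := MoveLeft | Stay | MoveRight.

(* A two-way infinite tape: [tleft] lists the cells to the left of the head, *)
(* nearest first, and all unlisted cells are blank.                          *)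
Record tape := Tape { tleft : seq symbol; tcur : symbol; tright : seq symbol }.

Definition tape_of_right (l r : seq symbol) : tape :=
  Tape l (head None r) (behead r).

Definition write_move (t : tape) (s : symbol) (m : direction) : tape :=
  match m with
  | MoveLeft => Tape (behead (tleft t)) (head None (tleft t)) (s :: tright t)
  | Stay => Tape (tleft t) s (tright t)
  | MoveRight => tape_of_right (s :: tleft t) (tright t)
  end.

Record machine := Machine {
  ntapes : nat; (* the number of tapes minus one *)
  state : finType;
  start : state;
  halted : pred state;
  delta : state -> {ffun 'I_ntapes.+1 -> symbol} ->
          state * {ffun 'I_ntapes.+1 -> symbol * direction} }.

Record config (M : machine) := Config {
  cstate : state M;
  ctape : 'I_(ntapes M).+1 -> tape }.

Definition step (M : machine) (c : config M) : config M :=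
  if halted (cstate c) then c else
  let: (q, act) := delta (cstate c) [ffun i => tcur (ctape c i)] in
  Config q (fun i => write_move (ctape c i) (act i).1 (act i).2).

Definition init (M : machine) (w : seq bool) : config M :=
  Config (start M)
    (fun i => tape_of_right [::] (if i == ord0 then map some w else [::])).

Fixpoint until_blank (s : seq symbol) : seq bool :=
  if s is Some b :: s' then b :: until_blank s' else [::].

(* The output is the word on tape 0 from the head up to the first blank. *)
Definition output (M : machine) (c : config M) : seq bool :=
  until_blank (tcur (ctape c ord0) :: tright (ctape c ord0)).

Definition computes_within (M : machine) (t : nat) (w v : seq bool) : Prop :=
  let c := iter t (@step M) (init M w) in halted (cstate c) /\ output c = v.

Definition polytime (A B : Type) (encA : A -> seq bool) (encB : B -> seq bool)
    (f : A -> B) : Prop :=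
  exists (M : machine) (c d : nat), forall a : A,
    computes_within M (c * size (encA a) ^ d + c) (encA a) (encB (f a)).

(* Main.v *)
(** Call an edge xy reducible if it is a bridge both of whose sides have at
    least k + 2 vertices. Contracting a reducible edge preserves the answer: a
    path partition of G / xy can be split along the bridge, unless all of one
    side of the bridge lies in the bag of the contracted vertex, and then that
    bag alone costs more than k contractions. In a yes-instance without
    reducible edges, two consecutive singleton bags are joined by a bridge and
    hence lie within k + 1 bags of one end of the path; since at most k bags are
    not singletons, there are at most 5k + 3 vertices. So one contracts
    reducible edges as long as there are any, and then outputs the remaining
    graph if it is small enough and a triangle with k = 0 otherwise.

    For the running time, the algorithm is written in an imperative language
    whose loops run up to a bound fixed on entry and whose numbers saturate at
    the length N of the input. It compiles to counters that are head positions
    on tapes of length N, and every program in it runs in polynomial time. *)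
Require Import Defs.
From mathcomp Require Import all_boot zify.
From Stdlib Require Import FunctionalExtensionality IndefiniteDescription.

Set Implicit Arguments.
Unset Strict Implicit.
Unset Printing Implicit Defensive.

(** * Contractions as maps with connected fibres *)

(** A sequence of contractions is awkward to rearrange, so it is replaced by the map that sends each
    vertex to its bag: a surjection with connected fibres. The number of contractions is then just
    the difference of the two vertex counts. The constant arises as follows. A path with [4k + 4]
    bags has [k + 1] of them at either end and [k + 1] disjoint pairs of consecutive bags in
    between. Without reducible edges every such pair contains a bag that is not a singleton, which
    is one contraction too many. So there are at most [4k + 3] bags, and at most [k] further
    vertices. The parameter never changes: undoing the contraction of a reducible edge lengthens the
    path by one and costs nothing. As [k] is given in binary, it may exceed every number that the
    program can hold. The program therefore calculates with [min(k, N)], which is harmless because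
    [k] is only used in comparisons with vertex counts, all of them below [N]; the digits of [k] are
    copied to the output verbatim. *)

Lemma connect_hom (T U : finType) (e : rel T) (e' : rel U) (h : T -> U) a b :
  (forall u v, e u v -> connect e' (h u) (h v)) ->
  connect e a b -> connect e' (h a) (h b).
Proof.
move=> he /connectP [p]; elim: p a => [|c p IHp] a /=; first by move=> _ ->.
by case/andP=> /he eac /IHp IH /IH; apply: connect_trans.
Qed.

(** The fibres are the bags of a contraction. This form does not depend on the order in which edges
    are contracted. *)
Definition contraction_map (G H : sgraph) (f : G -> H) : Prop :=
  [/\ forall a, exists x, f x = a,
      forall x y, f x = f y ->
        connect (fun u v => sedge u v && (f u == f v)) x y,
      forall x y, sedge x y -> f x = f y \/ sedge (f x) (f y) &
      forall a b, sedge a b -> exists x y, [/\ f x = a, f y = b & sedge x y]].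

Lemma sedge_neq (G : sgraph) (x y : G) : sedge x y -> x <> y.
Proof. by move=> e exy; rewrite exy sedge_irr in e. Qed.

Lemma isomorphic_contraction_map (G H : sgraph) (f : G -> H) :
  bijective f -> (forall x y, sedge (f x) (f y) = sedge x y) ->
  contraction_map f.
Proof.
move=> bf ef; have [g fK gK] := bf; split.
- by move=> a; exists (g a).
- by move=> x y /(bij_inj bf) ->.
- by move=> x y; rewrite ef; right.
- by move=> a b; rewrite -{1}(gK a) -{1}(gK b) ef => eab; exists (g a), (g b).
Qed.

(** For the fibres of the composite, a path inside a fibre of [g] is lifted edge by edge, and the
    ends of successive lifted edges are joined inside a fibre of [f]. *)
Lemma contraction_map_comp (G H K : sgraph) (f : G -> H) (g : H -> K) :
  contraction_map f -> contraction_map g -> contraction_map (g \o f).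
Proof.
move=> [fs fc fe fE] [gs gc ge gE]; split.
- by move=> a; have [b <-] := gs a; have [x <-] := fs b; exists x.
- move=> x y /= /gc /connectP [p].
  elim: p x => [|h p IHp] x /=.
    move=> _ /esym /fc; apply: connect_sub => u v /andP [euv /eqP fuv].
    by rewrite connect1 //= euv fuv eqxx.
  case/andP=> /andP [/fE [x1 [x2 [e1 e2 e12]]] /eqP eg] pp l.
  have c1 : connect (fun u v => sedge u v && (g (f u) == g (f v))) x x1.
    move/esym/fc: e1; apply: connect_sub => u v /andP [euv /eqP fuv].
    by rewrite connect1 //= euv fuv eqxx.
  apply: connect_trans c1 _; apply: connect_trans (connect1 (y := x2) _) _.
    by rewrite e12 e1 e2 eg eqxx.
  by apply: IHp; rewrite e2.
- move=> x y /fe /= [->|/ge //]; by left.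
- move=> a b /gE [h [h' [<- <- /fE [x [y [<- <- exy]]]]]]; by exists x, y.
Qed.

(** Cancelling a contraction on the right is what lets a map that merges the ends of an edge descend
    to the contracted graph. *)
Lemma contraction_map_factor (G H K : sgraph) (f : G -> H) (g : H -> K) :
  contraction_map f -> contraction_map (g \o f) -> contraction_map g.
Proof.
move=> [fs fc fe fE] [gs gc ge gE]; split.
- by move=> a; have [x <-] := gs a; exists (f x).
- move=> a b; have [x <-] := fs a; have [y <-] := fs b => /gc.
  apply: connect_hom => u v /andP [/fe [->//|euv] /= eg].
  by rewrite connect1 // euv.
- move=> a b /fE [x [y [<- <- exy]]]; exact: ge exy.
- move=> a b eab; have [x [y /= [ex ey exy]]] := gE _ _ eab.
  exists (f x), (f y); split=> //; have [efxy|//] := fe _ _ exy.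
  by case: (sedge_neq eab); rewrite -ex -ey efxy.
Qed.

Definition contract_proj (G : sgraph) (x y : G) : G -> contract x y :=
  fun z => insub z.

Lemma contract_projl (G : sgraph) (x y : G) : contract_proj x y x = None.
Proof. by apply: insubN; rewrite eqxx. Qed.

Lemma contract_projr (G : sgraph) (x y : G) : contract_proj x y y = None.
Proof. by apply: insubN; rewrite eqxx andbF. Qed.

Lemma contract_proj_Some (G : sgraph) (x y : G) z :
  contract_proj x y (val z) = Some z.
Proof. by rewrite /contract_proj valK. Qed.

Variant contract_proj_spec (G : sgraph) (x y z : G) : contract x y -> Prop :=
| ContractProjNone of z = x \/ z = y : contract_proj_spec z None
| ContractProjSome w of z = val w : contract_proj_spec z (Some w).

Lemma contract_projP (G : sgraph) (x y z : G) :
  contract_proj_spec z (contract_proj x y z).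
Proof.
rewrite /contract_proj; case: insubP => [w _ <-|]; first exact: ContractProjSome.
rewrite negb_and !negbK => /orP h; apply: ContractProjNone.
by case: h => /eqP; [left|right].
Qed.

Lemma contract_proj_map (G : sgraph) (x y : G) :
  sedge x y -> contraction_map (contract_proj x y).
Proof.
move=> exy; split.
- case=> [w|]; last by exists x; rewrite contract_projl.
  by exists (val w); rewrite contract_proj_Some.
- move=> u v.
  set e := fun u v => _; have exy' : connect e x y.
    by rewrite connect1 // /e exy contract_projl contract_projr eqxx.
  have eyx' : connect e y x.
    by rewrite connect1 // /e sedge_sym exy contract_projl contract_projr eqxx.
  case: (contract_projP x y u) => [hu|w ->];
    case: (contract_projP x y v) => [hv|w' ->] // h; last by case: h => ->.
  by case: hu hv => -> [] ->.
- move=> u v euv.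
  case: contract_projP => [hu|w ew]; case: contract_projP => [hv|w' ew'].
  + by left.
  + by right=> /=; rewrite -ew'; case: hu => <-; rewrite euv ?orbT.
  + by right=> /=; rewrite -ew sedge_sym in euv *; case: hv => <-; rewrite euv ?orbT.
  + by right=> /=; rewrite -ew -ew'.
- case=> [w|] [w'|] //= e.
  + by exists (val w), (val w'); rewrite !contract_proj_Some.
  + case/orP: e => e; [exists (val w), x | exists (val w), y];
      by rewrite contract_proj_Some ?contract_projl ?contract_projr sedge_sym.
  + case/orP: e => e; [exists x, (val w') | exists y, (val w')];
      by rewrite contract_proj_Some ?contract_projl ?contract_projr.
Qed.

Lemma card_contract (G : sgraph) (x y : G) :
  sedge x y -> #|G| = #|contract x y|.+1.
Proof.
move=> exy; rewrite card_option card_sig.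
have <- : #|predC (pred2 x y)| = #|[pred z | (z != x) && (z != y)]|.
  by apply: eq_card => z; rewrite !inE negb_or.
rewrite -(cardC (pred2 x y)) card2.
by case: eqP (sedge_neq exy).
Qed.

Lemma contraction_map_factor_contract (G H : sgraph) (f : G -> H) x y :
  sedge x y -> contraction_map f -> f x = f y ->
  exists2 g : contract x y -> H, contraction_map g & f =1 g \o contract_proj x y.
Proof.
move=> exy cf efxy.
pose g (u : contract x y) := if u is Some w then f (val w) else f x.
have fg : f =1 g \o contract_proj x y.
  by move=> z /=; case: contract_projP => [[]|w] ->.
exists g => //; apply: contraction_map_factor (contract_proj_map exy) _.
case: cf => fs fc fe fE; split.
- by move=> a; have [u <-] := fs a; exists u; rewrite fg.
- move=> u v; rewrite -!fg => /fc; apply: connect_sub => a b /andP [eab h].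
  by rewrite connect1 // eab -!fg.
- by move=> u v /fe; rewrite !fg.
- by move=> a b /fE [u [v]]; rewrite !fg => h; exists u, v.
Qed.

(** From right to left: if [G] has more vertices than [H], some fibre has two vertices; being
    connected, it contains an edge, and [f] factors through the contraction of that edge. If the
    counts agree, [f] is bijective and an isomorphism. *)
Lemma contracts_inP m (G H : sgraph) : contracts_in m G H <->
  (exists f : G -> H, contraction_map f) /\ #|G| = #|H| + m.
Proof.
split.
  elim=> {m G H} [G H [f bf ef]|m G x y H exy _ [[g cg] card_g]].
    rewrite addn0 (bij_eq_card bf); split=> //; exists f.
    exact: isomorphic_contraction_map.
  rewrite (card_contract exy) card_g addnS; split=> //.
  by exists (g \o contract_proj x y); apply: contraction_map_comp (contract_proj_map exy) _.
elim: m G => [|m IHm] G [[f cf] card_f]; have [fs fc fe fE] := cf.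
  have fi : injective f.
    suff /imset_injP h : #|f @: setT| == #|[set: G]|.
      by move=> a b; apply: h; rewrite !inE.
    have -> : f @: setT = setT.
      apply/setP=> a; rewrite inE; apply/imsetP.
      by have [x <-] := fs a; exists x.
    by rewrite !cardsT card_f addn0.
  apply: contracts_in0; exists f; first by apply: inj_card_bij; rewrite ?card_f ?addn0.
  move=> x y; apply/idP/idP => [/fE [u [v [/fi -> /fi ->]]] //|exy].
  by case: (fe _ _ exy) => // /fi /(sedge_neq exy).
have /injectivePn [x [y nxy exy]] : ~~ injectiveb f.
  by apply/negP=> /injectiveP /leq_card; rewrite card_f; lia.
have /connectP [[|z p]] := fc _ _ exy; first by move=> _ /esym /eqP; rewrite (negbTE nxy).
case/andP=> /andP [exz /eqP fxz] _ _.
apply: (contracts_inS exz); apply: IHm.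
have [g cg _] := contraction_map_factor_contract exz cf fxz.
by split; [exists g | move: card_f; rewrite (card_contract exz); lia].
Qed.

(** The number of contractions is forced by the vertex counts, and surjectivity already gives that
    the path is no larger than [G], so only an upper bound on [#|G|] remains. *)
Lemma contractible_to_pathP k (G : sgraph) : contractible_to_path k G <->
  exists n, (exists f : G -> path_graph n.+1, contraction_map f) /\ #|G| <= n.+1 + k.
Proof.
split=> [[n [m lmk /contracts_inP [h hm]]]|[n [[f cf] hm]]].
  by exists n; split=> //; rewrite hm card_ord leq_add2l.
have hn : n.+1 <= #|G|.
  have [fs _ _ _] := cf.
  have <- : #|f @: setT| = n.+1.
    rewrite -[RHS]card_ord -cardsT; congr #|pred_of_set _|.
    by apply/setP=> a; rewrite inE; apply/imsetP; have [x <-] := fs a; exists x.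
  exact: leq_trans (leq_imset_card _ _) (max_card _).
exists n, (#|G| - n.+1); first by lia.
by apply/contracts_inP; split; [exists f | rewrite card_ord; lia].
Qed.

(** * The bridge rule *)

Lemma path_graph_edge n (i j : path_graph n) :
  sedge i j = (i.+1 == j :> nat) || (j.+1 == i :> nat).
Proof. by []. Qed.

Lemma path_merge_map n (i : nat) : i.+1 < n.+2 ->
  contraction_map (fun j : path_graph n.+2 =>
    inord (if j <= i then nat_of_ord j else j.-1) : path_graph n.+1).
Proof.
move=> lt_in.
have vE (j : path_graph n.+2) :
    (inord (if j <= i then nat_of_ord j else j.-1) : 'I_n.+1) =
    (if j <= i then nat_of_ord j else j.-1) :> nat.
  by rewrite inordK //; have := ltn_ord j; case: ifP; lia.
split.
- move=> a; have ltan := ltn_ord a.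
  exists (inord (if a <= i then nat_of_ord a else a.+1) : path_graph n.+2).
  by apply: val_inj; rewrite /= vE inordK; repeat case: ifP; lia.
- move=> x y /(congr1 val); rewrite /= !vE => h.
  have [->//|nxy] := eqVneq x y.
  have exy : sedge x y.
    rewrite path_graph_edge; have : nat_of_ord x != y by rewrite -val_eqE in nxy.
    by move: h; repeat case: ifP; lia.
  by apply: connect1; apply/andP; split=> //; apply/eqP/val_inj; rewrite /= !vE.
- move=> x y; rewrite !path_graph_edge !vE => h.
  have [e|ne] := eqVneq (if x <= i then nat_of_ord x else x.-1)
    (if y <= i then nat_of_ord y else y.-1).
    by left; apply: val_inj; rewrite /= !vE.
  by right; move: h ne; repeat case: ifP; lia.
- move=> a b; rewrite path_graph_edge => h; have ltan := ltn_ord a; have ltbn := ltn_ord b.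
  (* [lo c d] lifts the end [c] of an edge whose other end is [d]. Only the merged position [i] has
     a choice: it lifts to [i] if [d] lies below it and to [i.+1] if [d] lies above. *)
  pose lo (c d : nat) := if (c <= i) && ((c < i) || (d < c)) then c else c.+1.
  exists (inord (lo a b) : path_graph n.+2), (inord (lo b a) : path_graph n.+2).
  have la : lo a b < n.+2 by rewrite /lo; case: ifP; lia.
  have lb : lo b a < n.+2 by rewrite /lo; case: ifP; lia.
  split.
  + by apply: val_inj; rewrite /= vE inordK //; move: la; rewrite /lo; repeat case: ifP; lia.
  + by apply: val_inj; rewrite /= vE inordK //; move: lb; rewrite /lo; repeat case: ifP; lia.
  + by rewrite path_graph_edge !inordK //; rewrite /lo; repeat case: ifP; lia.
Qed.

(** This direction works for any edge. Either both ends share a bag and the map descends, or their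
    bags are neighbours; merging these two bags shortens the path by one, just as the graph loses
    one vertex. *)
Lemma contractible_to_path_contract k (G : sgraph) (x y : G) :
  sedge x y -> contractible_to_path k G -> contractible_to_path k (contract x y).
Proof.
move=> exy /contractible_to_pathP [n [[f cf] cardG]].
apply/contractible_to_pathP; rewrite (card_contract exy) in cardG.
have [efxy|nefxy] := eqVneq (f x) (f y).
  have [g cg _] := contraction_map_factor_contract exy cf efxy.
  by exists n; split; [exists g | lia].
have [_ _ fe _] := cf.
have fadj : sedge (f x) (f y).
  by case: (fe _ _ exy) => // h; rewrite h eqxx in nefxy.
have lx := ltn_ord (f x); have ly := ltn_ord (f y).
case: n f cf cardG nefxy fe fadj lx ly => [|n] f cf cardG nefxy fe fadj lx ly.
  by move: fadj; rewrite path_graph_edge; lia.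
pose i := minn (f x) (f y).
have lt_i : i.+1 < n.+2 by move: fadj; rewrite path_graph_edge /i; lia.
have cg := contraction_map_comp cf (path_merge_map lt_i).
have [|g cg' _] := contraction_map_factor_contract exy cg.
  rewrite /=; congr inord; move: fadj; rewrite path_graph_edge /i.
  by repeat case: ifP; lia.
by exists n; split; [exists g | lia].
Qed.

(** Each of the [n] other fibres contains a vertex. *)
Lemma card_contraction_map_fibre (G : sgraph) n (f : G -> path_graph n.+1)
    (a : path_graph n.+1) :
  contraction_map f -> n + #|[set z | f z == a]| <= #|G|.
Proof.
move=> [fs _ _ _].
rewrite -(cardsC [set z | f z == a]) addnC leq_add2l.
have cardC : #|[set~ a]| = n by rewrite cardsC1 card_ord.
rewrite -[X in X <= _]cardC.
apply: leq_trans (leq_imset_card f _); apply: subset_leq_card.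
apply/subsetP=> b; rewrite !inE => nba; have [z fz] := fs b.
by apply/imsetP; exists z; rewrite ?inE ?fz.
Qed.

Definition bridge_side (G : sgraph) (x y : G) (S : {set G}) : Prop :=
  [/\ x \in S, y \notin S &
      forall u v, sedge u v -> u \in S -> v \notin S -> u = x /\ v = y].

Lemma bridge_sideC (G : sgraph) (x y : G) (S : {set G}) :
  bridge_side x y S -> bridge_side y x (~: S).
Proof.
case=> xS yS h; split; rewrite ?inE ?negbK // => u v euv; rewrite !inE negbK => uS vS.
by rewrite sedge_sym in euv; have [] := h v u euv vS uS.
Qed.

Lemma bridge_side_mem (G : sgraph) (x y : G) (S : {set G}) u v :
  bridge_side x y S -> sedge u v ->
  [\/ (u \in S) = (v \in S), u = x /\ v = y | u = y /\ v = x].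
Proof.
move=> [xS yS h] euv; case uS: (u \in S); case vS: (v \in S).
- by constructor 1.
- by constructor 2; apply: h => //; rewrite vS.
- constructor 3; rewrite sedge_sym in euv.
  by have [] := h v u euv vS; rewrite ?uS.
- by constructor 1.
Qed.

(** The common bag of [x] and [y] is cut along the bridge: its part outside [S] and all later bags
    move up by one position. Both parts stay connected because only the bridge joins them. *)
Lemma bridge_split (G : sgraph) n k (f : G -> path_graph n.+1) (x y : G) (S : {set G}) :
  contraction_map f -> f x = f y -> sedge x y -> bridge_side x y S ->
  (forall z, f z < f x -> z \in S) -> (forall z, f x < f z -> z \notin S) ->
  #|G| <= n.+2 + k -> contractible_to_path k G.
Proof.
move=> [fs fc fe fE] efxy exy bS loS hiS cardG.
have [xS yS _] := bS.
apply/contractible_to_pathP; exists n.+1; split=> //.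
pose F (z : G) : path_graph n.+2 := inord (f z + (z \notin S)).
have FE z : F z = f z + (z \notin S) :> nat.
  by rewrite inordK //; have := ltn_ord (f z); case: (z \in S); lia.
have leS z : z \in S -> f z <= f x by case: leqP (hiS z) => // _ /(_ isT) /negbTE ->.
have geS z : z \notin S -> f x <= f z by case: leqP (loS z) => // _ /(_ isT) ->.
have FP z w : F z = F w <-> f z = f w /\ (z \in S) = (w \in S).
  split; last by move=> [e1 e2]; rewrite /F e1 e2.
  move/(congr1 val); rewrite /= !FE.
  case zS: (z \in S); case wS: (w \in S) => /= h; split=> //.
  - by apply: ord_inj; lia.
  - by have := leS _ zS; have := geS w; rewrite wS; lia.
  - by have := leS _ zS; have := geS w; rewrite wS; lia.
  - by have := leS _ wS; have := geS z; rewrite zS; lia.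
  - by have := leS _ wS; have := geS z; rewrite zS; lia.
  - by apply: ord_inj; lia.
have efxy' : f x = f y :> nat by rewrite efxy.
have lfx := ltn_ord (f x).
exists F; split.
- move=> a; have la := ltn_ord a.
  have [ltax|lexa] := ltnP a (f x).
    have [z fz] := fs (inord a); have fz' : f z = a :> nat by rewrite fz inordK; lia.
    by exists z; apply: val_inj; rewrite /= FE fz' loS ?fz' // addn0.
  have [eax|nax] := eqVneq (a : nat) (f x).
    by exists x; apply: val_inj; rewrite /= FE xS addn0.
  have [eax|nax'] := eqVneq (a : nat) (f x).+1.
    by exists y; apply: val_inj; rewrite /= FE yS -efxy eax addn1.
  have [z fz] := fs (inord a.-1).
  have fz' : f z = a.-1 :> nat by rewrite fz inordK; lia.
  by exists z; apply: val_inj; rewrite /= FE fz' hiS ?fz'; lia.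
- move=> z w /FP [efzw eS].
  (* [h] retracts the bag onto the side of [z], sending the other side to the end of the bridge on
     this side. The bridge collapses under [h], so a path in the whole bag becomes a walk in the
     half. *)
  pose h (u : G) := if (u \in S) == (z \in S) then u else if z \in S then x else y.
  suff : connect (fun u v => sedge u v && (F u == F v)) (h z) (h w).
    by rewrite /h -eS eqxx.
  have := fc _ _ efzw; apply: connect_hom => u v /andP [euv /eqP fuv].
  have [eSuv|[-> ->]|[-> ->]] := bridge_side_mem bS euv.
  + rewrite /h -eSuv; case: ifP => // _; apply: connect1.
    by apply/andP; split=> //; apply/eqP/FP.
  + by rewrite /h xS (negbTE yS); case: (z \in S).
  + by rewrite /h xS (negbTE yS); case: (z \in S).
- move=> u v euv; rewrite path_graph_edge !FE.
  have [eSuv|[-> ->]|[-> ->]] := bridge_side_mem bS euv.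
  + have [efuv|] := fe _ _ euv; first by left; apply/FP.
    by rewrite path_graph_edge -eSuv; right; lia.
  + by right; rewrite xS yS efxy; lia.
  + by right; rewrite xS yS efxy; lia.
(* The bridge joins the two halves of the split bag. Any other edge of the longer path comes from an
   edge of the shorter one, whose end in the split bag lies in the correct half because only the
   bridge crosses between the sides. *)
- have half (a b : path_graph n.+2) : a.+1 = b :> nat ->
    exists u v, [/\ F u = a, F v = b & sedge u v].
    move=> eab; have lb := ltn_ord b.
    have [eax|nax] := eqVneq (a : nat) (f x).
      by exists x, y; split=> //; apply: val_inj; rewrite /= FE ?xS ?yS -?efxy; lia.
    have [ltax|gtax] := ltnP a (f x).
      have [|u [v [fu fv euv]]] := fE (inord a) (inord b).
        by rewrite path_graph_edge !inordK; lia.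
      have fu' : f u = a :> nat by rewrite fu inordK; lia.
      have fv' : f v = b :> nat by rewrite fv inordK; lia.
      have uS : u \in S by apply: loS; rewrite fu'.
      have vS : v \in S.
        have [<-//|[eu _]|[eu _]] := bridge_side_mem bS euv.
          by rewrite eu in fu'; lia.
        by rewrite eu in fu'; lia.
      exists u, v; split=> //; apply: val_inj; rewrite /= FE ?uS ?vS; lia.
    have [|u [v [fu fv euv]]] := fE (inord a.-1) (inord b.-1).
      by rewrite path_graph_edge !inordK; lia.
    have fu' : f u = a.-1 :> nat by rewrite fu inordK; lia.
    have fv' : f v = b.-1 :> nat by rewrite fv inordK; lia.
    have vS : v \notin S by apply: hiS; rewrite fv'; lia.
    have uS : u \notin S.
      have [->//|[_ ev]|[_ ev]] := bridge_side_mem bS euv.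
        by rewrite ev in fv'; lia.
      by rewrite ev in fv'; lia.
    exists u, v; split=> //; apply: val_inj; rewrite /= FE ?uS ?vS; lia.
  move=> a b; rewrite path_graph_edge => /orP [/eqP /half //|/eqP /half [u [v [fu fv euv]]]].
  by exists v, u; rewrite sedge_sym.
Qed.

(** The bags at an interval of positions form a connected set. If the interval misses the bag that
    holds both ends of the bridge, this set cannot cross the bridge. *)
Lemma bridge_side_monochrome (G : sgraph) n (f : G -> path_graph n.+1)
    (x y : G) (S : {set G}) (I : pred nat) :
  contraction_map f -> f x = f y -> bridge_side x y S -> ~~ I (f x) ->
  (forall i j l, I i -> I l -> i <= j <= l -> I j) ->
  (forall z, I (f z) -> z \in S) \/ (forall z, I (f z) -> z \notin S).
Proof.
move=> [fs fc fe fE] efxy bS nIx Icvx.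
have edge u v : sedge u v -> I (f u) -> (u \in S) = (v \in S).
  move=> euv Iu; have [//|[eu _]|[eu _]] := bridge_side_mem bS euv.
    by rewrite eu (negbTE nIx) in Iu.
  by rewrite eu -efxy (negbTE nIx) in Iu.
have fibre u v : f u = f v -> I (f u) -> (u \in S) = (v \in S).
  move=> efuv Iu; have /connectP [p] := fc _ _ efuv.
  elim: p u {efuv} Iu => [|w p IHp] u Iu /=; first by move=> _ ->.
  case/andP=> /andP [euw /eqP fuw] pp l.
  by rewrite (edge _ _ euw Iu) (IHp w) // -fuw.
have mono d : forall u v, f v = f u + d :> nat -> I (f u) -> I (f v) ->
  (u \in S) = (v \in S).
  elim: d => [|d IHd] u v.
    by rewrite addn0 => /val_inj /esym efuv Iu _; apply: fibre.
  move=> efuv Iu Iv; have lv := ltn_ord (f v).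
  have [|w [v' [fw fv' ewv]]] := fE (inord (f u + d)) (f v).
    by rewrite path_graph_edge inordK; lia.
  have fw' : f w = f u + d :> nat by rewrite fw inordK; lia.
  have Iw : I (f w) by apply: (Icvx (f u) _ (f v)) => //; lia.
  by rewrite (IHd u w) // (edge w v') // (fibre v' v) // fv'.
have all_eq u v : I (f u) -> I (f v) -> (u \in S) = (v \in S).
  move=> Iu Iv; have [le|lt] := leqP (f u) (f v).
    by apply: (mono (f v - f u)) => //; lia.
  by apply/esym; apply: (mono (f u - f v)) => //; lia.
have [/existsP [u /andP [Iu uS]]|/existsPn h] := boolP [exists u, I (f u) && (u \in S)].
  by left=> z Iz; rewrite -(all_eq u z).
by right=> z Iz; have := h z; rewrite Iz.
Qed.

(** The bags to the left of the bag of [x] and [y] lie on one side of the bridge, and so do those to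
    the right. If the two sides differ, the bag can be split. If they agree, the other side lies
    entirely in the bag. *)
Lemma contractible_to_path_uncontract k (G : sgraph) (x y : G) (S : {set G}) :
  sedge x y -> bridge_side x y S -> k + 2 <= #|S| -> k + 2 <= #|~: S| ->
  contractible_to_path k (contract x y) -> contractible_to_path k G.
Proof.
move=> exy bS leS leSC /contractible_to_pathP [n [[g cg] cardG]].
pose f := g \o contract_proj x y.
have cf : contraction_map f := contraction_map_comp (contract_proj_map exy) cg.
have efxy : f x = f y by rewrite /f /= contract_projl contract_projr.
have {cardG}cardG : #|G| <= n.+2 + k by rewrite (card_contract exy); lia.
(* The bag is too large with [k + 3] vertices, since the other [n] bags are non-empty and
   [#|G| <= n.+2 + k]. It will contain a whole side together with the opposite end of the bridge,
   which explains the threshold [k + 2] for a side. *)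
have big (B : {set G}) : (forall z, z \in B -> f z = f x) -> k + 3 <= #|B| -> False.
  move=> hB leB; have := card_contraction_map_fibre (f x) cf.
  have : #|B| <= #|[set z | f z == f x]|.
    by apply: subset_leq_card; apply/subsetP=> z /hB fz; rewrite inE fz.
  lia.
have [xS yS _] := bS; have yxS := bridge_sideC bS.
have mid z : ~~ (f z < f x) -> ~~ (f x < f z) -> f z = f x.
  by move=> h1 h2; apply: ord_inj; lia.
have [||loS|loS'] := bridge_side_monochrome (I := fun i => i < f x) cf efxy bS.
- by rewrite ltnn.
- lia.
- have [||hiS|hiS] := bridge_side_monochrome (I := fun i => f x < i) cf efxy bS.
  + by rewrite ltnn.
  + lia.
  + case: (big (x |: ~: S)).
      move=> z; rewrite !inE => /orP [/eqP ->//|zS].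
      by apply: mid; apply: contraNN zS; [apply: loS|apply: hiS].
    by rewrite cardsU1 !inE xS; lia.
  + exact: bridge_split cf efxy exy bS loS hiS cardG.
- 
  have [||hiS|hiS] := bridge_side_monochrome (I := fun i => f x < i) cf efxy bS.
  + by rewrite ltnn.
  + lia.
  + apply: (bridge_split cf (esym efxy) _ yxS _ _ cardG); first by rewrite sedge_sym.
      by move=> z; rewrite -efxy inE; apply: loS'.
    by move=> z; rewrite -efxy inE negbK; apply: hiS.
  + case: (big (y |: S)).
      move=> z; rewrite !inE => /orP [/eqP ->//|zS].
      by apply: mid; apply: contraTN zS; [apply: loS'|apply: hiS].
    by rewrite cardsU1 yS; lia.
Qed.

(** * Irreducible graphs *)

(** Only the arc from [x] to [y] is deleted: the reverse arc can be used only after [y] has been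
    reached, and then the edge is no bridge. *)
Definition near_side (G : sgraph) (x y : G) : {set G} :=
  [set b | connect (fun u v => sedge u v && ~~ ((u == x) && (v == y))) x b].

(** The last condition bounds the far side from below, in the additive form that the program can
    evaluate without subtraction. *)
Definition reducible_edge (k : nat) (G : sgraph) (x y : G) : bool :=
  [&& sedge x y, y \notin near_side x y, k + 2 <= #|near_side x y| &
      k + 2 + #|near_side x y| <= #|G|].

Lemma near_side_bridge (G : sgraph) (x y : G) :
  y \notin near_side x y -> bridge_side x y (near_side x y).
Proof.
move=> yN; split=> // [|u v euv]; first by rewrite inE connect0.
rewrite !inE => cu; have [/andP [/eqP -> /eqP ->] //|nuv] := boolP ((u == x) && (v == y)).
by move/negP; case; apply: connect_trans cu (connect1 _); rewrite euv nuv.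
Qed.

Lemma reducible_edge_safe k (G : sgraph) (x y : G) : reducible_edge k x y ->
  (contractible_to_path k G <-> contractible_to_path k (contract x y)).
Proof.
case/and4P=> exy yN leN leNC; split; first exact: contractible_to_path_contract.
apply: contractible_to_path_uncontract exy (near_side_bridge yN) leN _.
by move: (cardsC (near_side x y)) leNC; lia.
Qed.

Lemma card_fibres_gt (G : sgraph) n (f : G -> path_graph n.+1) (B : {set 'I_n.+1}) :
  contraction_map f -> (forall i, i \in B -> 1 < #|[set z | f z == i]|) ->
  n.+1 + #|B| <= #|G|.
Proof.
move=> [fs _ _ _] hB.
have -> : #|G| = \sum_(i : 'I_n.+1) #|[set z | f z == i]|.
  rewrite -[LHS]sum1_card (partition_big f xpredT) //=.
  by apply: eq_bigr => i _; rewrite -sum1_card; apply: eq_bigl => z; rewrite inE.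
rewrite -{1}[n.+1]card_ord -sum1_card -sum1_card [\sum_(i in B) 1]big_mkcond -big_split /=.
apply: leq_sum => i _; case: ifP => [/hB //|_].
by rewrite addn0 card_gt0; apply/set0Pn; have [z fz] := fs i; exists z; rewrite inE fz.
Qed.

Lemma card_ord_leq n (i : 'I_n) : #|[set j : 'I_n | j <= i]| = i.+1.
Proof.
have w_inj : injective (widen_ord (ltn_ord i)).
  by move=> a b /(congr1 val) /= /ord_inj.
rewrite -[RHS]card_ord -cardsT -(card_imset _ w_inj); apply: eq_card => j.
rewrite inE; apply/idP/imsetP => [leji|[a _ ->]]; last by rewrite /= -ltnS.
by exists (Ordinal (leji : j < i.+1)) => //; apply: val_inj.
Qed.

(** Edges join vertices in equal or neighbouring bags. Between two consecutive singleton bags there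
    is thus just one edge, and it separates the bags up to [f x] from the later ones. These sides
    have at least [f x + 1] and [n - f x] vertices. *)
Lemma contraction_map_reducible_edge k (G : sgraph) n (f : G -> path_graph n.+1)
    (x y : G) :
  contraction_map f ->
  [set z | f z == f x] = [set x] -> [set z | f z == f y] = [set y] ->
  f y = (f x).+1 :> nat -> k < f x -> f x + k + 2 <= n -> reducible_edge k x y.
Proof.
move=> [fs fc fe fE] fx1 fy1 efy lo hi.
have onlyx z : f z = f x :> nat -> z = x.
  by move/ord_inj=> e; apply/set1P; rewrite -fx1 inE e.
have onlyy z : f z = f y :> nat -> z = y.
  by move/ord_inj=> e; apply/set1P; rewrite -fy1 inE e.
have exy : sedge x y.
  have [|u [v [/(congr1 val) fu /(congr1 val) fv]]] := fE (f x) (f y).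
    by rewrite path_graph_edge efy eqxx.
  by rewrite (onlyx u) // (onlyy v).
have sideE : near_side x y = [set z | f z <= f x].
  apply/setP=> z; rewrite !inE; apply/idP/idP.
    case/connectP=> p pp ->; set e := fun u v => _ in pp.
    have: forall a, f a <= f x -> path e a p -> f (last a p) <= f x; last exact.
    elim: p {pp} => [|b p IHp] a //= lea /andP [/andP [eab nab] pp].
    apply: IHp pp; have [<-//|] := fe _ _ eab; rewrite path_graph_edge => adj.
    rewrite leqNgt; apply/negP=> ltb; case/negP: nab.
    have ea : a = x by apply: onlyx; lia.
    have eb : b = y by apply: onlyy; lia.
    by rewrite ea eb !eqxx.
  (* Induction on the distance from the bag of [x]: a vertex one bag closer has been reached, an
     edge leads into the bag of [z], and this bag is connected. None of these steps uses [y], which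
     lies beyond [f x]. *)
  have: forall d z, f z + d = f x -> connect (fun u v : G =>
    sedge u v && ~~ ((u == x) && (v == y))) x z; last first.
    by move=> h lez; apply: (h (f x - f z)); lia.
  elim=> [|d IHd] {}z efz; first by rewrite (onlyx z) ?connect0; lia.
  have lx := ltn_ord (f x).
  have [|u [v [fu fv euv]]] := fE (inord (f z).+1) (f z).
    by rewrite path_graph_edge inordK; lia.
  have fu' : f u = (f z).+1 :> nat by rewrite fu inordK; lia.
  apply: connect_trans (IHd u _) _; first by lia.
  apply: connect_trans (connect1 (y := v) _) _.
    apply/andP; split=> //; apply/negP=> /andP [_ /eqP ev].
    by move: (congr1 val fv); rewrite /= ev; lia.
  have := fc v z fv; apply: connect_sub => a b /andP [eab /eqP efab].
  apply: connect1; apply/andP; split=> //; apply/negP=> /andP [/eqP ea /eqP eb].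
  by move: (congr1 val efab); rewrite /= ea eb; lia.
have card_lo : f x < #|near_side x y|.
  rewrite sideE -card_ord_leq.
  apply: leq_trans (leq_imset_card f _); apply: subset_leq_card.
  apply/subsetP=> i; rewrite inE => lei; have [z fz] := fs i.
  by apply/imsetP; exists z; rewrite ?inE ?fz.
have card_hi : n - f x <= #|~: near_side x y|.
  rewrite sideE; have := cardsC [set i : 'I_n.+1 | i <= f x].
  rewrite card_ord_leq card_ord.
  suff : #|~: [set i : 'I_n.+1 | i <= f x]| <= #|~: [set z | f z <= f x]| by lia.
  apply: leq_trans (leq_imset_card f _); apply: subset_leq_card.
  apply/subsetP=> i; rewrite !inE => lei; have [z fz] := fs i.
  by apply/imsetP; exists z; rewrite ?inE ?fz.
apply/and4P; split=> //; first by rewrite sideE inE efy ltnn.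
  by lia.
by rewrite -(cardsC (near_side x y)); lia.
Qed.

Lemma irreducible_card k (G : sgraph) :
  contractible_to_path k G -> (forall x y : G, ~~ reducible_edge k x y) ->
  #|G| <= 5 * k + 3.
Proof.
move=> /contractible_to_pathP [n [[f cf] cardG]] irr.
rewrite leqNgt; apply/negP=> ltG.
have ltn : 4 * k + 3 <= n by lia.
pose big (i : 'I_n.+1) := 1 < #|[set z | f z == i]|.
have [fs _ _ _] := cf.
have single (i : 'I_n.+1) : ~~ big i -> exists x, [set z | f z == i] = [set x].
  rewrite -leqNgt => le1; apply/cards1P; rewrite eqn_leq le1 card_gt0.
  by apply/set0Pn; have [z fz] := fs i; exists z; rewrite inE fz.
(* The pairs occupy the positions [k + 1] to [3k + 2]. For [j = k] the condition [f x + k + 2 <= n]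
   reads [4k + 3 <= n], which is exactly what is available. *)
pose lo (j : nat) : 'I_n.+1 := inord (k.+1 + j.*2).
pose hi (j : nat) : 'I_n.+1 := inord (k.+1 + j.*2).+1.
have loE (j : 'I_k.+1) : lo j = k.+1 + j.*2 :> nat.
  by rewrite inordK //; have := ltn_ord j; lia.
have hiE (j : 'I_k.+1) : hi j = (k.+1 + j.*2).+1 :> nat.
  by rewrite inordK //; have := ltn_ord j; lia.
have one_big (j : 'I_k.+1) : big (lo j) || big (hi j).
  apply/negPn/negP; rewrite negb_or => /andP [/single [x ex] /single [y ey]].
  have lj := ltn_ord j.
  have fx : f x = lo j by apply/eqP; have := set11 x; rewrite -ex inE.
  have fy : f y = hi j by apply/eqP; have := set11 y; rewrite -ey inE.
  case/negP: (irr x y); apply: contraction_map_reducible_edge cf _ _ _ _ _.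
  - by rewrite fx.
  - by rewrite fy.
  - by rewrite fx fy loE hiE.
  - by rewrite fx loE; lia.
  - by rewrite fx loE; lia.
pose g (j : 'I_k.+1) := if big (lo j) then lo j else hi j.
have g_inj : injective g.
  move=> i j /(congr1 val); rewrite /g /=.
  by case: ifP; case: ifP; rewrite ?loE ?hiE => _ _ e; apply: ord_inj; lia.
have := card_fibres_gt (B := g @: setT) cf.
rewrite card_imset // cardsT card_ord => h.
have: n.+1 + k.+1 <= #|G|; last by lia.
apply: h => i /imsetP [j _ ->]; rewrite -/(big _) /g.
by case: ifP => // nb; have := one_big j; rewrite nb.
Qed.

(** * Connectedness, invariance under isomorphism, and a fixed no-instance *)

Lemma contraction_map_connected (G H : sgraph) (f : G -> H) :
  contraction_map f -> connected_graph G -> connected_graph H.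
Proof.
move=> [fs _ fe _] [/card_gt0P [x _] cG]; split.
  by apply/card_gt0P; exists (f x).
move=> a b; have [u <-] := fs a; have [v <-] := fs b.
apply: connect_hom (cG u v) => {}u {}v /fe [->//|]; exact: connect1.
Qed.

Lemma isomorphic_sym (G H : sgraph) : isomorphic G H -> isomorphic H G.
Proof.
case=> f [g fK gK] ef; exists g; first by exists f.
by move=> x y; rewrite -ef !gK.
Qed.

Lemma isomorphic_contractible_to_path k (G H : sgraph) :
  isomorphic G H -> contractible_to_path k G <-> contractible_to_path k H.
Proof.
have half (G1 G2 : sgraph) : isomorphic G1 G2 ->
    contractible_to_path k G1 -> contractible_to_path k G2.
  move=> /isomorphic_sym [f bf ef] /contractible_to_pathP [n [[g cg] cardG]].
  apply/contractible_to_pathP; exists n; rewrite (bij_eq_card bf); split=> //.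
  exists (g \o f); apply: contraction_map_comp cg.
  exact: isomorphic_contraction_map.
by move=> iso; split; apply: half => //; apply: isomorphic_sym.
Qed.

Lemma isomorphic_connected (G H : sgraph) :
  isomorphic G H -> connected_graph G -> connected_graph H.
Proof.
by case=> f bf ef; apply: contraction_map_connected (isomorphic_contraction_map bf ef).
Qed.

Section Triangle.

Definition triangle_adj : rel 'I_3 := fun i j => i != j.

Lemma triangle_adj_sym : symmetric triangle_adj.
Proof. by move=> i j; rewrite /triangle_adj eq_sym. Qed.

Lemma triangle_adj_irr : irreflexive triangle_adj.
Proof. by move=> i; rewrite /triangle_adj eqxx. Qed.

Definition triangle_instance : instance :=
  Instance triangle_adj_sym triangle_adj_irr 0.

(** With parameter 0 the path would have at least three positions, and two adjacent vertices would
    land at positions 0 and 2. *)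
Lemma triangle_no : ~ yes_instance triangle_instance.
Proof.
case/contractible_to_pathP=> n [[f [fs _ fe _]]]; rewrite card_ord addn0 => le3n.
have [x fx] := fs (inord 0); have [y fy] := fs (inord 2).
have fx' : f x = 0 :> nat by rewrite fx inordK.
have fy' : f y = 2 :> nat by rewrite fy inordK.
have [exy|nxy] := eqVneq x y; first by rewrite exy fy' in fx'.
have [e|] := fe x y nxy; first by rewrite e fy' in fx'.
by rewrite path_graph_edge fx' fy'.
Qed.

Lemma triangle_connected : connected_graph (graph_of triangle_instance).
Proof.
split=> [|x y]; first by rewrite card_ord.
by have [->//|nxy] := eqVneq x y; apply: connect1.
Qed.

End Triangle.

(** * Structured programs for multitape machines *)

Section TapePrograms.
Variable m : nat.

Notation tapes := ('I_m.+1 -> tape).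
Notation reading := {ffun 'I_m.+1 -> symbol}.
Notation action := {ffun 'I_m.+1 -> symbol * direction}.

Inductive tprog :=
| TAct of reading -> action
| TSeq of tprog & tprog
| TIf of pred reading & tprog & tprog
| TWhile of pred reading & tprog.

Definition stay_action (r : reading) : action := [ffun i => (r i, Stay)].

Definition read_tapes (T : tapes) : reading := [ffun i => tcur (T i)].

Definition apply_action (T : tapes) (a : action) : tapes :=
  fun i => write_move (T i) (a i).1 (a i).2.

Lemma apply_stay T : apply_action T (stay_action (read_tapes T)) = T.
Proof.
apply: functional_extensionality => i.
by rewrite /apply_action /stay_action !ffunE /=; case: (T i).
Qed.

(* A control state inside a conditional or a loop is [Some _]; [None] is the  *)
(* state in which its test is performed.                                      *)
Fixpoint tstate (p : tprog) : finType :=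
  match p with
  | TAct _ => unit
  | TSeq p q => (tstate p + tstate q)%type
  | TIf _ p q => option (tstate p + tstate q)
  | TWhile _ p => option (tstate p)
  end.

Fixpoint tentry (p : tprog) : tstate p :=
  match p with
  | TAct _ => tt
  | TSeq p q => inl (tentry p)
  | TIf _ p q => None
  | TWhile _ p => None
  end.

(* The next state is [None] when the program terminates. *)
Fixpoint tnext (p : tprog) : tstate p -> reading -> option (tstate p) * action :=
  match p with
  | TAct f => fun _ r => (None, f r)
  | TSeq p q => fun s r =>
      match s with
      | inl s => let: (s', a) := tnext s r in
          (Some (if s' is Some s' then inl s' else inr (tentry q)), a)
      | inr s => let: (s', a) := tnext s r in (omap inr s', a)
      end
  | TIf b p q => fun s r =>
      match s with
      | None => (Some (Some (if b r then inl (tentry p) else inr (tentry q))), stay_action r)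
      | Some (inl s) => let: (s', a) := tnext s r in (omap (Some \o inl) s', a)
      | Some (inr s) => let: (s', a) := tnext s r in (omap (Some \o inr) s', a)
      end
  | TWhile b p => fun s r =>
      match s with
      | None => (if b r then Some (Some (tentry p)) else None, stay_action r)
      | Some s => let: (s', a) := tnext s r in (Some s', a)
      end
  end.

(** The last step is the one in which control leaves the program. There is no final state inside
    [p], so that [TSeq] can redirect the exit of its first part to the entry of the second at no
    cost in time. *)
Inductive exits (p : tprog) : tstate p -> tapes -> nat -> tapes -> Prop :=
| Exits1 s T a :
    tnext s (read_tapes T) = (None, a) -> exits s T 1 (apply_action T a)
| ExitsS s s' T a t T' :
    tnext s (read_tapes T) = (Some s', a) -> exits s' (apply_action T a) t T' ->
    exits s T t.+1 T'.

Definition run (p : tprog) := exits (tentry p).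

Lemma exits_inr p q s T t T' :
  @exits q s T t T' -> @exits (TSeq p q) (inr s) T t T'.
Proof.
elim=> {s T t T'} [s T a e|s s' T a t T' e _ IH]; first by apply: Exits1; rewrite /= e.
by apply: ExitsS IH; rewrite /= e.
Qed.

Lemma run_seq p q T1 t1 T2 t2 T3 :
  run p T1 t1 T2 -> run q T2 t2 T3 -> run (TSeq p q) T1 (t1 + t2) T3.
Proof.
rewrite /run /=; move: (tentry p) => s pr /(exits_inr p) qr.
elim: pr qr => {s T1 t1 T2} [s T a e|s s' T a t T' e _ IH] qr.
  by apply: ExitsS qr => /=; rewrite e.
by rewrite addSn; apply: ExitsS (IH qr); rewrite /= e.
Qed.

Lemma run_if b p q T t T' :
  run (if b (read_tapes T) then p else q) T t T' -> run (TIf b p q) T t.+1 T'.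
Proof.
rewrite /run /= => h; apply: ExitsS => //=; rewrite apply_stay.
case: ifP h => _.
  move: (tentry p) => s; elim=> {s T t T'} [s T a e|s s' T a t T' e _ IH].
    by apply: Exits1; rewrite /= e.
  by apply: ExitsS IH; rewrite /= e.
move: (tentry q) => s; elim=> {s T t T'} [s T a e|s s' T a t T' e _ IH].
  by apply: Exits1; rewrite /= e.
by apply: ExitsS IH; rewrite /= e.
Qed.

Lemma run_while_stop (b : pred reading) p T : ~~ b (read_tapes T) -> run (TWhile b p) T 1 T.
Proof.
move=> /negbTE nb; rewrite -{2}(apply_stay T); apply: Exits1.
by rewrite /= nb.
Qed.

Lemma run_while_step (b : pred reading) p T1 t1 T2 t2 T3 : b (read_tapes T1) ->
  run p T1 t1 T2 -> run (TWhile b p) T2 t2 T3 ->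
  run (TWhile b p) T1 (t1 + t2).+1 T3.
Proof.
rewrite /run /= => hb pr wr; apply: (ExitsS (s' := Some (tentry p) : tstate (TWhile b p))).
  by rewrite /= hb.
rewrite apply_stay {hb}; move: (tentry p) pr => s pr.
elim: pr wr => {s T1 t1 T2} [s T a e|s s' T a t T' e _ IH] wr.
  by apply: ExitsS wr => /=; rewrite e.
by rewrite addSn; apply: ExitsS (IH wr); rewrite /= e.
Qed.

Definition tmachine (p : tprog) : machine :=
  @Machine m (option (tstate p)) (Some (tentry p)) (fun s => s == None)
    (fun s r => if s is Some s then tnext s r else (None, stay_action r)).

(** [computes_within] inspects the configuration at the time bound rather than at the moment of
    halting; a halted configuration is fixed by [step], so nothing changes in between. *)
Lemma run_tmachine p (T : tapes) t T' t' : run p T t T' -> t <= t' ->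
  iter t' (@step (tmachine p)) (@Config (tmachine p) (Some (tentry p)) T) =
  @Config (tmachine p) None T'.
Proof.
rewrite /run => + le_t; rewrite -(subnK le_t) iterD; move: (t' - t) => d.
have halt_fix : forall d, iter d (@step (tmachine p)) (@Config (tmachine p) None T') =
    @Config (tmachine p) None T' by elim=> //= e ->.
move: (tentry p) => s pr; rewrite -[RHS](halt_fix d); congr (iter d).
elim: pr {le_t halt_fix} => {s T t} [s T a e|s s' T a t {}T' e _ IH].
  by rewrite /= /step /= -/(read_tapes T) e.
by rewrite iterSr -IH; congr (iter t); rewrite /step /= -/(read_tapes T) e.
Qed.

Definition hoare (p : tprog) (T : tapes) (b : nat) (Q : tapes -> Prop) : Prop :=
  exists t T', [/\ t <= b, run p T t T' & Q T'].

Lemma hoare_weaken p T b b' (Q Q' : tapes -> Prop) : b <= b' ->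
  (forall T', Q T' -> Q' T') -> hoare p T b Q -> hoare p T b' Q'.
Proof.
move=> leb QQ' [t [T' [let_ r q]]]; exists t, T'; split=> //; last exact: QQ'.
exact: leq_trans leb.
Qed.

Lemma hoare_le p T b b' (Q : tapes -> Prop) :
  b <= b' -> hoare p T b Q -> hoare p T b' Q.
Proof. by move=> leb; apply: hoare_weaken. Qed.

Lemma hoare_act f T (Q : tapes -> Prop) :
  Q (apply_action T (f (read_tapes T))) -> hoare (TAct f) T 1 Q.
Proof. by move=> q; exists 1, (apply_action T (f (read_tapes T))); split=> //; apply: Exits1. Qed.

Lemma hoare_seq p q T b1 b2 (Q1 Q2 : tapes -> Prop) : hoare p T b1 Q1 ->
  (forall T', Q1 T' -> hoare q T' b2 Q2) -> hoare (TSeq p q) T (b1 + b2) Q2.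
Proof.
move=> [t1 [T1 [le1 r1 q1]]] /(_ _ q1) [t2 [T2 [le2 r2 q2]]].
by exists (t1 + t2), T2; split=> //; [apply: leq_add | apply: run_seq r1 r2].
Qed.

Lemma hoare_if b p q T B (Q : tapes -> Prop) :
  hoare (if b (read_tapes T) then p else q) T B Q -> hoare (TIf b p q) T B.+1 Q.
Proof. by case=> t [T' [le r qq]]; exists t.+1, T'; split=> //; apply: run_if. Qed.

(** [I] is indexed by the number of rounds still to come, which makes termination and the time bound
    one induction. *)
Lemma hoare_while (b : pred reading) p B (I : nat -> tapes -> Prop) :
  (forall j T, I j.+1 T -> b (read_tapes T) /\ hoare p T B (I j)) ->
  (forall T, I 0 T -> ~~ b (read_tapes T)) ->
  forall k T, I k T -> hoare (TWhile b p) T (k * B.+1 + 1) (I 0).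
Proof.
move=> hS h0; elim=> [|k IHk] T IT.
  by exists 1, T; split=> //; apply: run_while_stop; apply: h0.
have [bT [t1 [T1 [le1 r1 /IHk [t2 [T2 [le2 r2 q2]]]]]]] := hS _ _ IT.
exists (t1 + t2).+1, T2; split=> //; last exact: run_while_step r1 r2.
by move: le1 le2; lia.
Qed.

End TapePrograms.

(** * Counters and arrays *)

Definition upd (T : Type) (f : nat -> T) (i : nat) (v : T) : nat -> T :=
  fun j => if j == i then v else f j.

Lemma upd_eq T (f : nat -> T) i v : upd f i v i = v.
Proof. by rewrite /upd eqxx. Qed.

Lemma upd_neq T (f : nat -> T) i v j : j != i -> upd f i v j = f j.
Proof. by rewrite /upd => /negbTE ->. Qed.

(** Position 0 is the cell where the head starts. Nothing is said about the cells to its left,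
    because no head ever goes there. *)
Definition tape_at (t : tape) (p : nat) (c : nat -> symbol) : Prop :=
  [/\ tcur t = c p, forall j, nth None (tright t) j = c (p + j.+1) &
      forall j, j < p -> nth None (tleft t) j = c (p - j.+1)].

Lemma tape_at_write t p c s : tape_at t p c ->
  tape_at (write_move t s Stay) p (upd c p s).
Proof.
move=> [hc hr hl]; split=> /= [|j|j ltj]; first by rewrite upd_eq.
  by rewrite upd_neq ?hr //; lia.
by rewrite upd_neq ?hl //; lia.
Qed.

Lemma tape_at_stay t p c : tape_at t p c -> tape_at (write_move t (tcur t) Stay) p c.
Proof. by []. Qed.

Lemma tape_at_right t p c : tape_at t p c ->
  tape_at (write_move t (tcur t) MoveRight) p.+1 c.
Proof.
move=> [hc hr hl]; split=> /= [|j|[|j] ltj].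
- by rewrite -nth0 hr addn1.
- by rewrite nth_behead hr addSnnS.
- by rewrite /= hc subSS subn0.
- by rewrite /= hl // subSS.
Qed.

Lemma tape_at_left t p c : 0 < p -> tape_at t p c ->
  tape_at (write_move t (tcur t) MoveLeft) p.-1 c.
Proof.
move=> p_gt0 [hc hr hl]; split=> /= [|[|j]|j ltj].
- by rewrite -nth0 hl // subn1.
- by rewrite /= hc; congr c; lia.
- by rewrite /= hr; congr c; lia.
- by rewrite nth_behead hl; [congr c|]; lia.
Qed.

(* A counter tape reads 0 1^(N-1) followed by blanks and its value is the     *)
(* position of the head: both 0 and the maximal value N can be recognised.    *)
Definition counter_cells (N j : nat) : symbol :=
  if j == 0 then Some false else if j < N then Some true else None.

Lemma counter_cells_zero N j : 0 < N -> (counter_cells N j == Some false) = (j == 0).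
Proof. by rewrite /counter_cells; case: j => //= j; case: ifP. Qed.

Lemma counter_cells_max N j : 0 < N -> (counter_cells N j == None) = (N <= j).
Proof. by rewrite /counter_cells; case: j => [|j] /= N0; [case: N N0|case: ltnP]. Qed.

(** The primitives are chosen so that each can be carried out by a bounded number of simultaneous
    head sweeps. *)
Inductive cmd :=
| CSkip
| CZero of nat
| CMax of nat
| CInc of nat
| CSet of nat & nat
| CWrite of nat & nat & symbol
| CSeq of cmd & cmd
| CIfLe of nat & nat & cmd & cmd
| CIfArr of nat & nat & symbol & cmd & cmd
| CFor of nat & nat & cmd.

Record store := Store { cv : nat -> nat; av : nat -> nat -> symbol }.

Definition setc (s : store) x v := Store (upd (cv s) x v) (av s).
Definition seta (s : store) a i b := Store (cv s) (upd (av s) a (upd (av s a) i b)).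

(* [CFor c x p] consumes its bound: the register [x] ends at 0. *)
Fixpoint csem (N : nat) (p : cmd) (s : store) : store :=
  match p with
  | CSkip => s
  | CZero x => setc s x 0
  | CMax x => setc s x N
  | CInc x => setc s x (minn (cv s x).+1 N)
  | CSet x y => setc s x (cv s y)
  | CWrite a x b => seta s a (cv s x) b
  | CSeq p q => csem N q (csem N p s)
  | CIfLe x y p q => if cv s x <= cv s y then csem N p s else csem N q s
  | CIfArr a x b p q => if av s a (cv s x) == b then csem N p s else csem N q s
  | CFor c x p => let X := cv s x in
      iteri X (fun j s' => setc (setc (csem N p s') c j.+1) x (X - j.+1)) (setc s c 0)
  end.

Fixpoint cwrites (p : cmd) (y : nat) : bool :=
  match p with
  | CSkip | CWrite _ _ _ => false
  | CZero x | CMax x | CInc x | CSet x _ => y == x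
  | CSeq p q | CIfLe _ _ p q | CIfArr _ _ _ p q => cwrites p y || cwrites q y
  | CFor c x p => [|| y == c, y == x | cwrites p y]
  end.

Fixpoint cwf (p : cmd) : bool :=
  match p with
  | CSet x y => x != y
  | CSeq p q | CIfLe _ _ p q | CIfArr _ _ _ p q => cwf p && cwf q
  | CFor c x p => [&& c != x, ~~ cwrites p c, ~~ cwrites p x & cwf p]
  | _ => true
  end.

Fixpoint cregs (p : cmd) : nat :=
  match p with
  | CSkip => 0
  | CZero x | CMax x | CInc x | CWrite _ x _ => x.+1
  | CSet x y => maxn x.+1 y.+1
  | CSeq p q => maxn (cregs p) (cregs q)
  | CIfLe x y p q => maxn (maxn x.+1 y.+1) (maxn (cregs p) (cregs q))
  | CIfArr a x b p q => maxn x.+1 (maxn (cregs p) (cregs q))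
  | CFor c x p => maxn (maxn c.+1 x.+1) (cregs p)
  end.

Fixpoint carrs (p : cmd) : nat :=
  match p with
  | CWrite a _ _ => a.+1
  | CSeq p q | CIfLe _ _ p q => maxn (carrs p) (carrs q)
  | CIfArr a _ _ p q => maxn a.+1 (maxn (carrs p) (carrs q))
  | CFor _ _ p => carrs p
  | _ => 0
  end.

(** A primitive needs at most three sweeps of at most [2N + 1] steps, as every cell costs a test and
    a move; [10 (N + 1)] is a generous common bound. *)
Fixpoint ctime (N : nat) (p : cmd) : nat :=
  match p with
  | CSeq p q => ctime N p + ctime N q
  | CIfLe _ _ p q | CIfArr _ _ _ p q => 10 * N.+1 + (ctime N p + ctime N q)
  | CFor c x p => 10 * N.+1 + N.+1 * (ctime N p + 10)
  | _ => 10 * N.+1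
  end.

Lemma ctime_poly p : exists c d, forall N, ctime N p <= c * N.+1 ^ d.
Proof.
have mono c d c' d' N : c <= c' -> d <= d' -> c * N.+1 ^ d <= c' * N.+1 ^ d'.
  by move=> hc hd; rewrite leq_mul // leq_pexp2l.
have base N : 10 * N.+1 <= 10 * N.+1 ^ 1 by rewrite expn1.
have sum2 p1 p2 : (exists c d, forall N, ctime N p1 <= c * N.+1 ^ d) ->
    (exists c d, forall N, ctime N p2 <= c * N.+1 ^ d) ->
  exists c d, forall N, 10 * N.+1 + (ctime N p1 + ctime N p2) <= c * N.+1 ^ d.
  move=> [c1 [d1 h1]] [c2 [d2 h2]]; exists (10 + (c1 + c2)), (d1 + d2).+1 => N.
  rewrite !mulnDl; apply: leq_add; [|apply: leq_add].
  - by apply: leq_trans (base N) _; apply: mono.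
  - by apply: leq_trans (h1 N) _; apply: mono => //; lia.
  - by apply: leq_trans (h2 N) _; apply: mono => //; lia.
elim: p => /=; try by move=> *; exists 10, 1 => N; apply: base.
- move=> p IHp q IHq; have [c [d h]] := sum2 _ _ IHp IHq; exists c, d => N.
  by apply: leq_trans (h N); rewrite leq_addl.
- by move=> _ _ p IHp q IHq; apply: sum2.
- by move=> _ _ _ p IHp q IHq; apply: sum2.
- move=> _ _ p [c [d h]]; exists (10 + (c + 10)), d.+1 => N.
  rewrite mulnDl; apply: leq_add; first by apply: leq_trans (base N) _; apply: mono.
  rewrite expnS mulnCA leq_mul2l mulnDl; apply/orP; right; apply: leq_add => //.
  by apply: leq_pmulr; rewrite expn_gt0.
Qed.

Lemma iteri_inv (S : Type) (f : nat -> S -> S) (s : S) (P : nat -> S -> Prop) n :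
  P 0 s -> (forall j s', j < n -> P j s' -> P j.+1 (f j s')) -> P n (iteri n f s).
Proof.
move=> P0 PS; elim: {-2}n (leqnn n) => [|j IHj] ltj //=.
by apply: PS => //; apply: IHj; apply: ltnW.
Qed.

Definition cbounded (N : nat) (s : store) := forall x, cv s x <= N.

Lemma cbounded_setc N s x v : cbounded N s -> v <= N -> cbounded N (setc s x v).
Proof. by move=> bs vN y; rewrite /= /upd; case: ifP. Qed.

Lemma csem_bounded N p s : cbounded N s -> cbounded N (csem N p s).
Proof.
elim: p s => /=; try by move=> *; apply: cbounded_setc => //; lia.
- by [].
- by [].
- by move=> p IHp q IHq s /IHp /IHq.
- by move=> x y p IHp q IHq s bs; case: ifP => _; [apply: IHp|apply: IHq].
- by move=> a x b p IHp q IHq s bs; case: ifP => _; [apply: IHp|apply: IHq].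
- move=> c x p IHp s bs; have leXN := bs x.
  apply: (iteri_inv (P := fun _ => cbounded N)); first exact: cbounded_setc.
  move=> j s' ltj bs'; apply: cbounded_setc; last by lia.
  by apply: cbounded_setc; [apply: IHp | lia].
Qed.

Lemma csem_frame N p s y : ~~ cwrites p y -> cv (csem N p s) y = cv s y.
Proof.
elim: p s => //=; try by move=> *; rewrite upd_neq.
- by move=> p IHp q IHq s; rewrite negb_or => /andP [np nq]; rewrite IHq // IHp.
- by move=> ? ? p IHp q IHq s; rewrite negb_or => /andP [np nq]; case: ifP => _; auto.
- by move=> ? ? ? p IHp q IHq s; rewrite negb_or => /andP [np nq]; case: ifP => _; auto.
- move=> c x p IHp s; rewrite !negb_or => /and3P [nc nx np].
  apply: (iteri_inv (P := fun _ s' => cv s' y = cv s y)); first by rewrite /= upd_neq.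
  by move=> j s' _ e; rewrite /= !upd_neq // IHp.
Qed.

(** * Counters and arrays on tapes *)

(** There is one tape per array, one per register and one scratch counter. [kind_of] puts the arrays
    first, so that array 0 lies on tape 0, where input and output are expected. *)
Definition tape_kind : Type := option (nat + nat).
Notation KArr a := (Some (inl a) : tape_kind).
Notation KCnt x := (Some (inr x) : tape_kind).
Notation KTmp := (None : tape_kind).

Section Compile.
Variables na nc : nat.
Let m := na + nc.

Definition kind_valid (u : tape_kind) : bool :=
  match u with Some (inl a) => a < na | Some (inr x) => x < nc | None => true end.

Definition kind_code (u : tape_kind) : nat :=
  match u with Some (inl a) => a | Some (inr x) => na + x | None => m end.

Definition kind_of (i : nat) : tape_kind :=
  if i < na then KArr i else if i < m then KCnt (i - na) else KTmp.

Lemma kind_codeK u : kind_valid u -> kind_of (kind_code u) = u.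
Proof.
rewrite /kind_of /m; case: u => [[a|x]|] /=; first by move=> ->.
  by move=> ltx; rewrite ltnNge leq_addr /= ltn_add2l ltx addKn.
by move=> _; rewrite ltnNge leq_addr ltnn.
Qed.

Lemma kind_code_lt u : kind_valid u -> kind_code u < m.+1.
Proof. by rewrite /m; case: u => [[a|x]|] /=; lia. Qed.

Notation tapes := ('I_m.+1 -> tape).
Notation reading := {ffun 'I_m.+1 -> symbol}.
Notation action := {ffun 'I_m.+1 -> symbol * direction}.

Definition move_heads (l r : seq tape_kind) (rd : reading) : action :=
  [ffun i : 'I_m.+1 => (rd i, if kind_of i \in l then MoveLeft
                    else if kind_of i \in r then MoveRight else Stay)].

Definition write_cell (u : tape_kind) (b : symbol) (rd : reading) : action :=
  [ffun i : 'I_m.+1 => (if kind_of i == u then b else rd i, Stay)].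

Definition reads (u : tape_kind) (b : symbol) : pred reading :=
  fun rd => rd (inord (kind_code u)) == b.

Definition nonzero (x : tape_kind) : pred reading :=
  fun rd => ~~ reads x (Some false) rd.

Definition shift_loop b l r := @TWhile m b (TAct (move_heads l r)).

(** The scratch counter has recorded the length of the preceding sweep; counting it down moves the
    chosen heads back by that distance. *)
Definition restore_loop l := shift_loop (nonzero KTmp) [:: KTmp & l].

(** An array access counts the index register down while the array head moves right, so that this
    head stops at the indexed cell. A comparison counts both registers down together: [x <= y] if
    and only if [x] is at 0 when the first of them gets there. [CSet] counts [y] down while [x] goes
    up, and then restores [y] alone. After a test, the restoring loop occurs in both branches
    because only the control state remembers the outcome. *)
Fixpoint ccomp (p : cmd) : tprog m :=
  match p with
  | CSkip => TAct (@stay_action m)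
  | CZero x => shift_loop (nonzero (KCnt x)) [:: KCnt x] [::]
  | CMax x => shift_loop (predC (reads (KCnt x) None)) [::] [:: KCnt x]
  | CInc x => TIf (reads (KCnt x) None) (TAct (@stay_action m))
                (TAct (move_heads [::] [:: KCnt x]))
  | CSet x y =>
      TSeq (shift_loop (nonzero (KCnt x)) [:: KCnt x] [::])
     (TSeq (shift_loop (nonzero (KCnt y)) [:: KCnt y] [:: KTmp; KCnt x])
           (restore_loop [::] [:: KCnt y]))
  | CWrite a x b =>
      TSeq (shift_loop (nonzero (KCnt x)) [:: KCnt x] [:: KTmp; KArr a])
     (TSeq (TAct (write_cell (KArr a) b))
           (restore_loop [:: KArr a] [:: KCnt x]))
  | CSeq p q => TSeq (ccomp p) (ccomp q)
  | CIfLe x y p q =>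
      TSeq (shift_loop (predI (nonzero (KCnt x)) (nonzero (KCnt y)))
              [:: KCnt x; KCnt y] [:: KTmp])
      (TIf (reads (KCnt x) (Some false))
        (TSeq (restore_loop [::] [:: KCnt x; KCnt y]) (ccomp p))
        (TSeq (restore_loop [::] [:: KCnt x; KCnt y]) (ccomp q)))
  | CIfArr a x b p q =>
      TSeq (shift_loop (nonzero (KCnt x)) [:: KCnt x] [:: KTmp; KArr a])
      (TIf (reads (KArr a) b)
        (TSeq (restore_loop [:: KArr a] [:: KCnt x]) (ccomp p))
        (TSeq (restore_loop [:: KArr a] [:: KCnt x]) (ccomp q)))
  | CFor c x p =>
      TSeq (shift_loop (nonzero (KCnt c)) [:: KCnt c] [::])
           (TWhile (nonzero (KCnt x))
              (TSeq (ccomp p) (TAct (move_heads [:: KCnt x] [:: KCnt c]))))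
  end.

Definition tapes_at (T : tapes) (P : tape_kind -> nat) (W : tape_kind -> nat -> symbol) :=
  forall i : 'I_m.+1, tape_at (T i) (P (kind_of i)) (W (kind_of i)).

Lemma tapes_at_eq T P W P' W' : tapes_at T P W ->
  P =1 P' -> (forall u, W u =1 W' u) -> tapes_at T P' W'.
Proof.
move=> h eP eW i; have [hc hr hl] := h i; rewrite -eP; split=> [|j|j ltj].
- by rewrite -eW.
- by rewrite -eW; apply: hr.
- by rewrite -eW; apply: hl.
Qed.

Lemma reads_at T P W u b : kind_valid u -> tapes_at T P W ->
  reads u b (read_tapes T) = (W u (P u) == b).
Proof.
move=> vu h; rewrite /reads /read_tapes ffunE.
by have [-> _ _] := h (inord (kind_code u)); rewrite inordK ?kind_code_lt // kind_codeK.
Qed.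

Definition shift (l r : seq tape_kind) (k : nat) (P : tape_kind -> nat) : tape_kind -> nat :=
  fun u => if u \in l then P u - k else if u \in r then P u + k else P u.

Lemma shift0 l r P : shift l r 0 P =1 P.
Proof. by move=> u; rewrite /shift subn0 addn0; case: ifP => // _; case: ifP. Qed.

Lemma tapes_at_move l r T P W : tapes_at T P W ->
  (forall u, u \in l -> 0 < P u) ->
  tapes_at (apply_action T (move_heads l r (read_tapes T))) (shift l r 1 P) W.
Proof.
move=> h hl i; rewrite /apply_action /move_heads !ffunE /shift /=.
case: ifP => [/hl|_]; first by rewrite subn1; move=> gt0; apply: tape_at_left.
by case: ifP => _; [rewrite addn1; apply: tape_at_right | apply: tape_at_stay].
Qed.

Lemma tapes_at_write u b T P W : tapes_at T P W ->
  tapes_at (apply_action T (write_cell u b (read_tapes T))) P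
    (fun v => if v == u then upd (W v) (P v) b else W v).
Proof.
move=> h i; rewrite /apply_action /write_cell !ffunE /=.
by case: ifP => _; [apply: tape_at_write | apply: tape_at_stay].
Qed.

Lemma hoare_shift_loop (b : pred reading) l r k T P W : tapes_at T P W ->
  (forall u, u \in l -> k <= P u) ->
  (forall T' j, j <= k -> tapes_at T' (shift l r j P) W -> b (read_tapes T') = (j < k)) ->
  hoare (shift_loop b l r) T (k.*2.+1) (fun T' => tapes_at T' (shift l r k P) W).
Proof.
move=> h hl hb.
apply: (@hoare_weaken _ _ _ (k * 2 + 1) _
  (fun T' => 0 <= k /\ tapes_at T' (shift l r (k - 0) P) W)); first by lia.
  by move=> T'; rewrite subn0; case.
apply: (hoare_while (I := fun j T' => j <= k /\ tapes_at T' (shift l r (k - j) P) W)).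
- move=> j T' [ltjk hT']; split; first by rewrite (hb _ (k - j.+1)) //; lia.
  apply: hoare_act; split; first exact: ltnW.
  apply: tapes_at_eq (tapes_at_move r hT' _) _ _ => //.
    by move=> u ul; rewrite /shift ul; have := hl _ ul; lia.
  by move=> u; rewrite /shift; case: (u \in l) => /=; [|case: (u \in r)]; lia.
- by move=> T' [_]; rewrite subn0 => /(hb _ _ (leqnn k)) ->; rewrite ltnn.
- by split=> //; rewrite subnn; apply: tapes_at_eq h _ _ => // u; rewrite shift0.
Qed.

Variable N : nat.
Hypothesis N_gt0 : 0 < N.

(** Between commands the heads of the arrays and of the scratch counter rest at position 0; only
    register heads carry information. *)
Definition store_pos (s : store) (u : tape_kind) : nat :=
  if u is Some (inr x) then cv s x else 0.

Definition store_cells (s : store) (u : tape_kind) : nat -> symbol :=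
  if u is Some (inl a) then av s a else counter_cells N.

Definition represents (s : store) (T : tapes) : Prop :=
  tapes_at T (store_pos s) (store_cells s).

Definition counter_kind (u : tape_kind) : bool := if u is Some (inl _) then false else true.

Lemma nonzero_at T P s u : kind_valid u -> counter_kind u ->
  tapes_at T P (store_cells s) -> nonzero u (read_tapes T) = (0 < P u).
Proof.
move=> vu cu h; rewrite /nonzero (reads_at _ vu h) lt0n.
by case: u cu {vu h} => [[a|x]|] //= _; rewrite counter_cells_zero.
Qed.

Lemma hoare_down_loop u l r T P s : kind_valid u -> counter_kind u ->
  u \in l -> (forall v, v \in l -> P u <= P v) -> tapes_at T P (store_cells s) ->
  hoare (shift_loop (nonzero u) l r) T (P u).*2.+1
    (fun T' => tapes_at T' (shift l r (P u) P) (store_cells s)).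
Proof.
move=> vu cu ul leu h; apply: hoare_shift_loop h _ _ => // T' j lej h'.
by rewrite (nonzero_at vu cu h') /shift ul; lia.
Qed.

(** Stated from the goal: [P] gives the positions to be reached, and the hypothesis describes the
    tapes as displaced from them by a sweep of length [k]. *)
Lemma hoare_restore_loop l r k T P s : KTmp \notin l -> KTmp \notin r ->
  (forall u, u \in r -> u \notin l) -> P KTmp = 0 -> (forall u, u \in l -> k <= P u) ->
  tapes_at T (shift l (KTmp :: r) k P) (store_cells s) ->
  hoare (restore_loop r l) T k.*2.+1 (fun T' => tapes_at T' P (store_cells s)).
Proof.
move=> ntl ntr dis P0 leP h.
have Pt : shift l (KTmp :: r) k P KTmp = k.
  by rewrite /shift (negbTE ntl) inE eqxx P0.
rewrite -[X in X.*2]Pt; apply: hoare_weaken (leqnn _) _ (hoare_down_loop _ _ _ _ _ h) => //.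
- move=> T' h'; apply: tapes_at_eq h' _ _ => // u; rewrite Pt /shift inE.
  have [->|nut] := eqVneq u KTmp; first by rewrite /= (negbTE ntl) P0; lia.
  rewrite /=; case ur: (u \in r); first by rewrite (negbTE (dis _ ur)); lia.
  by case ul: (u \in l) => //=; have := leP _ ul; lia.
- move=> u; rewrite Pt inE => /orP [/eqP ->|ur]; first by rewrite Pt.
  by rewrite /shift (negbTE (dis _ ur)) inE ur orbT; lia.
Qed.

Lemma kind_eqE :
  (forall x y, (KCnt x == KCnt y) = (x == y)) * (forall a b, (KArr a == KArr b) = (a == b)) *
  (forall x a, (KCnt x == KArr a) = false) * (forall x a, (KArr a == KCnt x) = false) *
  (forall x, (KCnt x == KTmp) = false) * (forall x, (KTmp == KCnt x) = false) *
  (forall a, (KArr a == KTmp) = false) * (forall a, (KTmp == KArr a) = false).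
Proof. by []. Qed.

Lemma represents_setc s x v T P : tapes_at T P (store_cells s) ->
  P =1 store_pos (setc s x v) -> represents (setc s x v) T.
Proof. by move=> h eP; apply: tapes_at_eq h eP _. Qed.

Lemma hoare_zero x s T : x < nc -> represents s T ->
  hoare (shift_loop (nonzero (KCnt x)) [:: KCnt x] [::]) T (cv s x).*2.+1
    (represents (setc s x 0)).
Proof.
move=> ltx h; apply: hoare_weaken (leqnn _) _ (hoare_down_loop (u := KCnt x) _ _ _ _ _ h) => //.
- move=> T' /represents_setc; apply=> -[[a|y]|] //; rewrite /shift inE kind_eqE /= /upd.
  by case: eqP => // ->; lia.
- by rewrite inE eqxx.
- by move=> v; rewrite inE => /eqP ->.
Qed.

Lemma hoare_goto a x s T : x < nc -> represents s T ->
  hoare (shift_loop (nonzero (KCnt x)) [:: KCnt x] [:: KTmp; KArr a]) T (cv s x).*2.+1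
    (fun T' => tapes_at T' (shift [:: KCnt x] [:: KTmp; KArr a] (cv s x) (store_pos s))
      (store_cells s)).
Proof.
move=> ltx h; apply: (hoare_down_loop (u := KCnt x) _ _ _ _ _ h) => //.
- by rewrite inE eqxx.
- by move=> v; rewrite inE => /eqP ->.
Qed.

Lemma hoare_goback a x s s' T : cv s' =1 cv s ->
  tapes_at T (shift [:: KCnt x] [:: KTmp; KArr a] (cv s x) (store_pos s)) (store_cells s') ->
  hoare (restore_loop [:: KArr a] [:: KCnt x]) T (cv s x).*2.+1 (represents s').
Proof.
move=> es h.
apply: hoare_weaken (leqnn _) _ (hoare_restore_loop _ _ _ _ _ h) => //.
- by move=> T' h'; apply: tapes_at_eq h' _ _ => // -[[b|y]|] //=.
- by move=> u; rewrite !inE => /eqP ->.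
- by move=> u; rewrite !inE => /eqP ->.
Qed.

Lemma ccomp_correct p s T : cwf p -> cregs p <= nc -> carrs p <= na ->
  cbounded N s -> represents s T ->
  hoare (ccomp p) T (ctime N p) (represents (csem N p s)).
Proof.
elim: p s T => /=.
- move=> s T _ _ _ _ h; apply: (@hoare_le _ _ _ 1) => //.
  by apply: hoare_act; rewrite apply_stay.
- move=> x s T _ ltx _ bs h; apply: hoare_weaken (hoare_zero ltx h) => //.
  by have := bs x; lia.
- move=> x s T _ ltx _ bs h; have lex := bs x.
  apply: (hoare_weaken _ _ (@hoare_shift_loop _ _ _ (N - cv s x) _ _ _ h _ _)) => //.
  + by lia.
  + move=> T' /represents_setc; apply=> -[[a|y]|] //; rewrite /shift inE kind_eqE /= /upd.
    by case: eqP => // ->; lia.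
  + move=> T' j lej h'; rewrite /= (reads_at (u := KCnt x) _ _ h') //=.
    by rewrite counter_cells_max // /shift inE eqxx /=; lia.
- move=> x s T _ ltx _ bs h; have lex := bs x.
  apply: (@hoare_le _ _ _ 2); first by lia.
  apply: hoare_if.
  rewrite (reads_at (u := KCnt x) _ _ h) //= counter_cells_max //.
  case: leqP => hN; apply: hoare_act.
    rewrite apply_stay; apply: represents_setc h _ => -[[a|y]|] //=; rewrite /upd.
    by case: eqP => // ->; lia.
  apply: represents_setc (tapes_at_move _ h _) _ => // -[[a|y]|] //.
  by rewrite /shift !inE kind_eqE /= /upd; case: eqP => // ->; lia.
- move=> x y s T nxy; rewrite geq_max => /andP [ltx lty] _ bs h.
  have lex := bs x; have ley := bs y.
  apply: (@hoare_le _ _ _ ((cv s x).*2.+1 + ((cv s y).*2.+1 + (cv s y).*2.+1)));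
    [lia | apply: hoare_seq (hoare_zero ltx h) _ => T1 h1].
  have ey : cv (setc s x 0) y = cv s y by rewrite /= upd_neq // eq_sym.
  apply: (@hoare_seq _ _ _ _ _ _ (fun T' => tapes_at T' (shift [:: KCnt y] [:: KTmp; KCnt x]
    (cv s y) (store_pos (setc s x 0))) (store_cells s))).
    rewrite -ey; apply: (hoare_down_loop (u := KCnt y) _ _ _ _ _ h1) => //.
      by rewrite inE eqxx.
    by move=> v; rewrite inE => /eqP ->.
  move=> T2 h2; apply: (@hoare_restore_loop [:: KCnt y] [::] (cv s y) T2
    (store_pos (setc s x (cv s y))) (setc s x (cv s y))) => //.
    by move=> v; rewrite inE => /eqP ->; rewrite /= upd_neq // eq_sym.
  apply: tapes_at_eq h2 _ _ => // -[[a|z]|] //; rewrite /shift !inE !kind_eqE /= /upd.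
  by case: (eqVneq z y) => [->|_]; [rewrite eq_sym (negbTE nxy); lia | case: (eqVneq z x) => //].
- move=> a x b s T _ ltx lta bs h; have lex := bs x.
  apply: (@hoare_le _ _ _ ((cv s x).*2.+1 + (1 + (cv s x).*2.+1)));
    [lia | apply: hoare_seq (hoare_goto a ltx h) _ => T1 h1].
  apply: (@hoare_seq _ _ _ _ _ _ (fun T' => tapes_at T'
    (shift [:: KCnt x] [:: KTmp; KArr a] (cv s x) (store_pos s))
    (store_cells (seta s a (cv s x) b)))); last by move=> T2; apply: hoare_goback.
  apply: hoare_act; apply: tapes_at_eq (tapes_at_write (KArr a) b h1) _ _ => //.
  move=> [[c|z]|] // j; rewrite kind_eqE /= /upd.
  by case: (eqVneq c a) => [->|//]; rewrite /shift !inE !kind_eqE eqxx.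
- move=> p IHp q IHq s T /andP [wp wq]; rewrite !geq_max => /andP [rp rq] /andP [ap aq] bs h.
  apply: hoare_seq (IHp _ _ wp rp ap bs h) _ => T1 h1.
  by apply: IHq => //; apply: csem_bounded.
- move=> x y p IHp q IHq s T /andP [wp wq]; rewrite !geq_max.
  move=> /andP [/andP [ltx lty] /andP [rp rq]] /andP [ap aq] bs h.
  have lex := bs x; have ley := bs y; set k := minn (cv s x) (cv s y).
  apply: (@hoare_le _ _ _ (k.*2.+1 + (k.*2.+1 + (ctime N p + ctime N q)).+1));
    [by rewrite /k; lia |].
  have memk u : u \in [:: KCnt x; KCnt y] -> k <= store_pos s u.
    by rewrite !inE => /orP [] /eqP -> /=; rewrite /k; lia.
  apply: hoare_seq (@hoare_shift_loop _ _ [:: KTmp] k _ _ _ h memk _) _.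
    move=> T' j lej h' /=; rewrite !(nonzero_at _ _ h') //.
    by rewrite /shift !inE !eqxx orbT /=; rewrite /k in lej *; lia.
  move=> T1 h1; apply: hoare_if.
  rewrite (reads_at (u := KCnt x) _ _ h1) //= counter_cells_zero // /shift inE eqxx /=.
  have -> : (cv s x - k == 0) = (cv s x <= cv s y) by rewrite /k; lia.
  have hr : hoare (restore_loop [::] [:: KCnt x; KCnt y]) T1 k.*2.+1 (represents s).
    by apply: hoare_restore_loop h1.
  case: leqP => _.
    apply: (@hoare_le _ _ _ (k.*2.+1 + ctime N p)); first by lia.
    by apply: hoare_seq hr _ => T2 h2; apply: IHp.
  apply: (@hoare_le _ _ _ (k.*2.+1 + ctime N q)); first by lia.
  by apply: hoare_seq hr _ => T2 h2; apply: IHq.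
- move=> a x b p IHp q IHq s T /andP [wp wq]; rewrite !geq_max.
  move=> /andP [ltx /andP [rp rq]] /andP [lta /andP [ap aq]] bs h; have lex := bs x.
  apply: (@hoare_le _ _ _ ((cv s x).*2.+1 + ((cv s x).*2.+1 + (ctime N p + ctime N q)).+1));
    [lia | apply: hoare_seq (hoare_goto a ltx h) _ => T1 h1].
  apply: hoare_if; rewrite (reads_at (u := KArr a) _ _ h1) //= /shift !inE kind_eqE eqxx /=.
  have hr : hoare (restore_loop [:: KArr a] [:: KCnt x]) T1 (cv s x).*2.+1 (represents s).
    by apply: hoare_goback h1.
  case: ifP => _.
    apply: (@hoare_le _ _ _ ((cv s x).*2.+1 + ctime N p)); first by lia.
    by apply: hoare_seq hr _ => T2 h2; apply: IHp.
  apply: (@hoare_le _ _ _ ((cv s x).*2.+1 + ctime N q)); first by lia.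
  by apply: hoare_seq hr _ => T2 h2; apply: IHq.
- move=> c x p IHp s T /and4P [ncx wc wx wp]; rewrite !geq_max.
  move=> /andP [/andP [ltc ltx] rp] ap bs h.
  have lex := bs x; have lec := bs c; set X := cv s x; set f := fun j s' => _.
  pose S j := iteri j f (setc s c 0).
  have SP j : j <= X -> [/\ cbounded N (S j), cv (S j) c = j & cv (S j) x = X - j].
    elim: j => [|j IHj] lejX.
      by rewrite /S /= upd_eq upd_neq ?(eq_sym x) // subn0; split=> //; apply: cbounded_setc.
    have [bS Sc Sx] := IHj (ltnW lejX); rewrite /S /= -/(S j) upd_eq upd_neq // upd_eq.
    split=> //; apply: cbounded_setc; last by rewrite /X; lia.
    by apply: cbounded_setc; [apply: csem_bounded | rewrite /X in lejX; lia].
  apply: (@hoare_le _ _ _ ((cv s c).*2.+1 + (X * (ctime N p + 1).+1 + 1))).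
  + have : X * (ctime N p + 1).+1 <= N.+1 * (ctime N p + 10).
      by apply: leq_mul; rewrite /X; lia.
    lia.
  apply: hoare_seq (hoare_zero ltc h) _ => T1 h1.
  apply: (@hoare_weaken _ _ _ (X * (ctime N p + 1).+1 + 1) _
    (fun T' => 0 <= X /\ represents (S (X - 0)) T')).
  + by [].
  + by move=> T' [_]; rewrite subn0.
  (* With [j] rounds to come, [X - j] rounds have been executed. *)
  apply: (hoare_while (I := fun j T' => j <= X /\ represents (S (X - j)) T')).
  + move=> j T' [ltjX h']; have [bS Sc Sx] := SP (X - j.+1) (leq_subr _ _).
    split; first by rewrite (nonzero_at (u := KCnt x) _ _ h') //= Sx; lia.
    apply: hoare_seq (IHp _ _ wp rp ap bS h') _ => T2 h2.
    apply: hoare_act; split; first exact: ltnW.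
    have -> : X - j = (X - j.+1).+1 by lia.
    rewrite /S /= -/(S _); apply: tapes_at_eq (tapes_at_move [:: KCnt c] h2 _) _ _ => //.
      by move=> u; rewrite inE => /eqP ->; rewrite /= csem_frame // Sx; lia.
    move=> [[a|z]|] //; rewrite /shift !inE !kind_eqE /= /upd.
    case: (eqVneq z x) => [->|nzx]; first by rewrite csem_frame // Sx; lia.
    by case: (eqVneq z c) => [->|nzc] //; rewrite csem_frame // Sc; lia.
  + by move=> T' [_]; rewrite subn0 => h'; have [_ _ Sx] := SP X (leqnn _);
      rewrite (nonzero_at (u := KCnt x) _ _ h') //= Sx subnn.
  + by split=> //; rewrite subnn.
Qed.
End Compile.

(** * Initialisation and running time *)

Lemma tapes_at_eq_valid na nc T P W P' W' : @tapes_at na nc T P W ->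
  (forall u, kind_valid na nc u -> P u = P' u) ->
  (forall u, kind_valid na nc u -> W u =1 W' u) -> tapes_at T P' W'.
Proof.
move=> h eP eW i; have [hc hr hl] := h i.
have vi : kind_valid na nc (kind_of na nc i).
  have := ltn_ord i; rewrite /kind_of; case: ifP => //= nlt; case: ifP => //=; lia.
rewrite -eP //; split=> [|j|j ltj].
- by rewrite -eW.
- by rewrite -eW //; apply: hr.
- by rewrite -eW //; apply: hl.
Qed.

Definition input_store (w : seq bool) : store :=
  Store (fun _ => 0) (fun a => if a == 0 then nth None (map some w) else fun _ => None).

Lemma nth_map_some_None (w : seq bool) j : (nth None (map some w) j == None) = (size w <= j).
Proof.
case: (leqP (size w) j) => hj; first by rewrite nth_default // size_map.
by rewrite (nth_map false).
Qed.

Section Setup.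
Variables (na nc : nat).
Hypothesis na_gt0 : 0 < na.
Let m := na + nc.

Definition fill_counters (b : symbol) (rd : {ffun 'I_m.+1 -> symbol}) :
    {ffun 'I_m.+1 -> symbol * direction} :=
  [ffun i : 'I_m.+1 =>
    match kind_of na nc i with
    | Some (inl a) => (rd i, if a == 0 then MoveRight else Stay)
    | _ => (b, MoveRight)
    end].

Definition all_counters : seq tape_kind :=
  [:: KTmp, KArr 0 & [seq KCnt x | x <- iota 0 nc]].

(** The input itself serves as the clock: while its head passes over the word, every counter tape
    receives one cell per symbol, first a 0 and then 1s. All these heads are then rewound together,
    the scratch counter telling when position 0 is reached. *)
Definition setup : tprog m :=
  TSeq (TAct (fill_counters (Some false)))
 (TSeq (TWhile (predC (@reads na nc (KArr 0) None)) (TAct (fill_counters (Some true))))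
       (shift_loop (@nonzero na nc KTmp) all_counters [::])).

Definition setup_pos (j : nat) (u : tape_kind) : nat :=
  if u is Some (inl a) then if a == 0 then j else 0 else j.

Lemma fill_counters_at b j T W : tapes_at T (setup_pos j) W ->
  tapes_at (apply_action T (fill_counters b (read_tapes T))) (setup_pos j.+1)
    (fun u => if u is Some (inl _) then W u else upd (W u) j b).
Proof.
move=> h i; have := h i; rewrite /apply_action /fill_counters !ffunE.
case: (kind_of na nc i) => [[a|x]|] /=; last 2 first.
- by move/(tape_at_write b)/tape_at_right.
- by move/(tape_at_write b)/tape_at_right.
by case: ifP => _; [apply: tape_at_right | apply: tape_at_stay].
Qed.

Lemma init_at p (w : seq bool) : tapes_at (ctape (init (@tmachine m p) w)) (setup_pos 0)
  (fun u => if u is Some (inl a) then av (input_store w) a else fun _ => None).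
Proof.
move=> i; have -> : setup_pos 0 (kind_of na nc i) = 0.
  by rewrite /setup_pos; case: (kind_of na nc i) => [[a|x]|] //; case: ifP.
rewrite /= -val_eqE /=; case: (eqVneq (i : nat) 0) => [->|ni].
  by rewrite /kind_of na_gt0 /=; split=> [|j|j] //=; rewrite ?nth_behead -?nth0.
have -> : tape_of_right [::] [::] = Tape [::] None [::] by [].
split=> // [|j] /=; rewrite ?nth_nil /kind_of; case: ifP => //=;
  rewrite ?(negbTE ni) //; case: ifP => //.
Qed.

Lemma setup_correct p (w : seq bool) : 0 < size w ->
  hoare setup (ctape (init (@tmachine m p) w)) (4 * size w + 4)
    (represents (size w) (input_store w)).
Proof.
move=> w_gt0; have h0 := init_at p w.
set N := size w; pose cells j u := store_cells j (input_store w) u.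
apply: (@hoare_le _ _ _ (1 + ((N.-1 * 2 + 1) + N.*2.+1))); first by lia.
apply: (@hoare_seq _ _ _ _ _ _ (fun T => tapes_at T (setup_pos 1) (cells 1))).
  apply: hoare_act; apply: tapes_at_eq (fill_counters_at _ h0) _ _ => //.
  by move=> [[a|x]|] // [|j].
move=> T1 h1.
apply: (@hoare_seq _ _ _ _ _ _
  (fun T => 0 < N /\ tapes_at T (setup_pos (N - 0)) (cells (N - 0)))).
  apply: (hoare_while (I := fun k T => k < N /\ tapes_at T (setup_pos (N - k)) (cells (N - k)))).
  - move=> k T [ltkN h]; split.
      rewrite /= (reads_at (u := KArr 0) _ _ h) //= nth_map_some_None -/N; lia.
    apply: hoare_act; split; first exact: ltnW.
    apply: tapes_at_eq (fill_counters_at _ h) _ _.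
      by move=> u; congr setup_pos; lia.
    have -> : N - k = (N - k.+1).+1 by lia.
    have : 0 < N - k.+1 by lia.
    move: (N - k.+1) => j j_gt0 [[a|x]|] // i; rewrite /cells /= /upd /counter_cells;
      by case: (eqVneq i j) => [->|nij];
        [rewrite ltnSn gtn_eqF | rewrite ltnS [i <= j]leq_eqVlt (negbTE nij)].
  - move=> T [_ h]; rewrite /= (reads_at (u := KArr 0) _ _ h) //= nth_map_some_None -/N; lia.
  - split; first by rewrite /N; lia.
    have -> : N - N.-1 = 1 by rewrite /N; lia.
    exact: h1.
move=> T2 [_]; rewrite subn0 => h2.
apply: hoare_weaken (leqnn _) _ (hoare_down_loop (u := KTmp) _ _ _ _ _ _ h2) => //.
- move=> T' h'; apply: tapes_at_eq_valid h' _ _ => // u vu; rewrite /shift.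
  case: ifP => [_|]; first by case: u vu => [[a|x]|] _ /=; [case: ifP| |]; lia.
  case: u vu => [[a|x]|] //= vu; first by case: (eqVneq a 0) => [->|].
  by rewrite !in_cons (map_f (fun x => KCnt x)) ?orbT // mem_iota.
- by move=> [[a|x]|]; rewrite // inE kind_eqE /= inE; case/orP; [move/eqP=> [->] | case/mapP].
Qed.
End Setup.

Lemma until_blank_spec (l : seq symbol) (v : seq bool) :
  (forall j, nth None l j = nth None (map some v) j) -> until_blank l = v.
Proof.
elim: v l => [|b v IHv] [|[c|] l] h //=; try by have := h 0.
have [->] := h 0; congr cons; apply: IHv => j; exact: (h j.+1).
Qed.

Lemma cmd_polytime (p : cmd) : cwf p -> exists (M : machine) (c d : nat),
  forall w v : seq bool, 0 < size w ->
    (forall j, av (csem (size w) p (input_store w)) 0 j = nth None (map some v) j) ->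
    computes_within M (c * size w ^ d + c) w v.
Proof.
move=> wp; have [c [d hcd]] := ctime_poly p.
pose na := (carrs p).+1; pose nc := cregs p.
(* The factor [2 ^ d] comes from [(N + 1)^d <= (2N)^d], and 8 pays for the setup, which takes at
   most [4N + 4] steps. *)
exists (tmachine (TSeq (setup na nc) (ccomp na nc p))), (8 + c * 2 ^ d), d.+1 => w v w_gt0 hv.
have [t [T [le_t rT repT]]] : hoare (TSeq (setup na nc) (ccomp na nc p))
    (ctape (init (tmachine (TSeq (setup na nc) (ccomp na nc p))) w))
    ((4 * size w + 4) + ctime (size w) p) (represents (size w) (csem (size w) p (input_store w))).
  apply: hoare_seq (setup_correct _ _ w_gt0) _ => // T1 h1.
  by apply: ccomp_correct.
have {}le_t : t <= (8 + c * 2 ^ d) * size w ^ d.+1 + (8 + c * 2 ^ d).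
  apply: leq_trans le_t _.
  have e1 : size w <= size w ^ d.+1 by rewrite -{1}(expn1 (size w)) leq_pexp2l.
  have e2 : ctime (size w) p <= c * 2 ^ d * size w ^ d.+1.
    apply: leq_trans (hcd _) _; rewrite -mulnA leq_mul2l; apply/orP; right.
    apply: (@leq_trans ((2 * size w) ^ d)); first by case: (d) => // d'; rewrite leq_exp2r //; lia.
    by rewrite expnMn leq_mul2l leq_pexp2l ?orbT.
  by rewrite mulnDl; lia.
rewrite /computes_within /= (run_tmachine rT le_t); split=> //.
rewrite /output; apply: until_blank_spec => j; rewrite -hv.
have := repT ord0; rewrite /kind_of /= => -[hc hr _].
by case: j => [|j] /=; [rewrite hc | rewrite hr].
Qed.

(** * Expressions and statements *)

(** [EVar] reads a register, [EBnd] a variable bound by a sum or a loop. Keeping the two apart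
    prevents programs from assigning to loop variables. *)
Inductive expr :=
| ECst of nat
| EMax
| EVar of nat
| EBnd of nat
| EAdd of expr & expr
| EMul of expr & expr
| ELe of expr & expr
| EArr of nat & expr & symbol
| ESum of nat & expr & expr.

Inductive stmt :=
| SSkip
| SAssign of nat & expr
| SWrite of nat & expr & symbol
| SSeq of stmt & stmt
| SIf of expr & stmt & stmt
| SFor of nat & expr & stmt.

(* All values saturate at the length [N] of the input, so every program runs  *)
(* in polynomial time. *)
Fixpoint eeval (N : nat) (s : store) (rho : nat -> nat) (e : expr) : nat :=
  match e with
  | ECst k => minn k N
  | EMax => N
  | EVar x => cv s x
  | EBnd i => rho i
  | EAdd e1 e2 => minn (eeval N s rho e1 + eeval N s rho e2) N
  | EMul e1 e2 => minn (eeval N s rho e1 * eeval N s rho e2) N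
  | ELe e1 e2 => eeval N s rho e1 <= eeval N s rho e2
  | EArr a e b => av s a (eeval N s rho e) == b
  | ESum i e1 e2 => minn (\sum_(j < eeval N s rho e1) eeval N s (upd rho i j) e2) N
  end.

Fixpoint ssem (N : nat) (rho : nat -> nat) (p : stmt) (s : store) : store :=
  match p with
  | SSkip => s
  | SAssign x e => setc s x (eeval N s rho e)
  | SWrite a e b => seta s a (eeval N s rho e) b
  | SSeq p q => ssem N rho q (ssem N rho p s)
  | SIf e p q => if 0 < eeval N s rho e then ssem N rho p s else ssem N rho q s
  | SFor i e p => iteri (eeval N s rho e) (fun j => ssem N (upd rho i j) p) s
  end.

(* The expression is evaluated into register [d], with the registers above    *)
(* [d] as scratch space; [r] gives the registers of the bound variables.      *)
Fixpoint ecomp (d : nat) (r : nat -> nat) (e : expr) : cmd :=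
  match e with
  | ECst k => CSeq (CZero d) (iter k (fun c => CSeq c (CInc d)) CSkip)
  | EMax => CMax d
  | EVar x => CSet d x
  | EBnd i => CSet d (r i)
  | EAdd e1 e2 =>
      CSeq (ecomp d r e1) (CSeq (ecomp d.+1 r e2) (CFor d.+2 d.+1 (CInc d)))
  | EMul e1 e2 =>
      CSeq (ecomp d.+1 r e1) (CSeq (ecomp d.+2 r e2) (CSeq (CZero d)
        (CFor d.+3 d.+1 (CSeq (CSet d.+4 d.+2) (CFor d.+4.+1 d.+4 (CInc d))))))
  | ELe e1 e2 =>
      CSeq (ecomp d.+1 r e1) (CSeq (ecomp d.+2 r e2) (CSeq (CZero d)
        (CIfLe d.+1 d.+2 (CInc d) CSkip)))
  | EArr a e b =>
      CSeq (ecomp d.+1 r e) (CSeq (CZero d) (CIfArr a d.+1 b (CInc d) CSkip))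
  | ESum i e1 e2 =>
      CSeq (ecomp d.+1 r e1) (CSeq (CZero d)
        (CFor d.+2 d.+1 (CSeq (ecomp d.+3 (upd r i d.+2) e2)
                              (CFor d.+4 d.+3 (CInc d)))))
  end.

Fixpoint scomp (d : nat) (r : nat -> nat) (p : stmt) : cmd :=
  match p with
  | SSkip => CSkip
  | SAssign x e => CSeq (ecomp d r e) (CSet x d)
  | SWrite a e b => CSeq (ecomp d r e) (CWrite a d b)
  | SSeq p q => CSeq (scomp d r p) (scomp d r q)
  | SIf e p q => CSeq (ecomp d r e) (CSeq (CZero d.+1)
                   (CIfLe d d.+1 (scomp d r q) (scomp d r p)))
  | SFor i e p => CSeq (ecomp d r e) (CFor d.+1 d (scomp d.+2 (upd r i d.+1) p))
  end.

Lemma cv_setc s x v : cv (setc s x v) = upd (cv s) x v.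
Proof. by []. Qed.

Ltac simp_upd := rewrite ?cv_setc; repeat first [rewrite upd_eq | rewrite upd_neq; [|by lia]].

Section Correctness.
Variables (U N : nat).

Fixpoint ewf (e : expr) : bool :=
  match e with
  | ECst _ | EMax | EBnd _ => true
  | EVar x => x < U
  | EAdd e1 e2 | EMul e1 e2 | ELe e1 e2 | ESum _ e1 e2 => ewf e1 && ewf e2
  | EArr _ e _ => ewf e
  end.

Fixpoint swf (p : stmt) : bool :=
  match p with
  | SSkip => true
  | SAssign x e => (x < U) && ewf e
  | SWrite _ e _ => ewf e
  | SSeq p q => swf p && swf q
  | SIf e p q => [&& ewf e, swf p & swf q]
  | SFor _ e p => ewf e && swf p
  end.

(** The registers from [U] on are scratch space of the compiled code, of which the source semantics
    knows nothing. *)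
Definition agree (s s' : store) : Prop :=
  (forall x, x < U -> cv s x = cv s' x) /\ av s = av s'.

Lemma eeval_agree s s' rho rho' e : ewf e -> agree s s' -> rho =1 rho' ->
  eeval N s rho e = eeval N s' rho' e.
Proof.
move=> + [ec ea]; elim: e rho rho' => //=.
- by move=> x rho rho' /ec ->.
- by move=> e1 IH1 e2 IH2 rho rho' /andP [w1 w2] er; rewrite (IH1 _ rho') // (IH2 _ rho').
- by move=> e1 IH1 e2 IH2 rho rho' /andP [w1 w2] er; rewrite (IH1 _ rho') // (IH2 _ rho').
- by move=> e1 IH1 e2 IH2 rho rho' /andP [w1 w2] er; rewrite (IH1 _ rho') // (IH2 _ rho').
- by move=> a e IH b rho rho' w er; rewrite ea (IH _ rho').
- move=> i e1 IH1 e2 IH2 rho rho' /andP [w1 w2] er; rewrite (IH1 _ rho') //.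
  congr minn; apply: eq_bigr => j _; apply: IH2 => // k.
  by rewrite /upd er.
Qed.

(** This is a stack discipline: partial results kept below [d] survive the evaluation of further
    subexpressions. *)
Lemma ecomp_writes d r e y : cwrites (ecomp d r e) y -> d <= y.
Proof.
elim: e d r => //=.
- by move=> k d r /orP [/eqP -> //|]; elim: k => //= k IHk /orP [/IHk //|/eqP ->].
- by move=> d r /eqP ->.
- by move=> x d r /eqP ->.
- by move=> x d r /eqP ->.
- by move=> e1 IH1 e2 IH2 d r /or3P [/IH1 //|/IH2 /ltnW //|]; lia.
- by move=> e1 IH1 e2 IH2 d r /or3P [/IH1|/IH2|]; lia.
- by move=> e1 IH1 e2 IH2 d r /or3P [/IH1|/IH2|]; lia.
- by move=> a e IH b d r /or3P [/IH||]; lia.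
- move=> i e1 IH1 e2 IH2 d r /or3P [/IH1||]; [lia..|].
  by case/or3P=> [||/orP [/IH2|]]; lia.
Qed.

Lemma ecomp_wf d r e : ewf e -> U <= d -> (forall i, r i < d) -> cwf (ecomp d r e).
Proof.
have nw d' r' e' y : y < d' -> ~~ cwrites (ecomp d' r' e') y.
  by move=> lt; apply/negP=> /ecomp_writes; rewrite leqNgt lt.
elim: e d r => //=.
- by move=> k d r _ _ _; elim: k => //= k ->.
- by move=> x d r ltx leU _; rewrite gtn_eqF //; apply: leq_trans leU.
- by move=> i d r _ _ /(_ i); lia.
- move=> e1 IH1 e2 IH2 d r /andP [w1 w2] leU hr.
  rewrite IH1 // IH2 // ?(leqW leU) //; last by move=> i; apply: leqW.
  by lia.
- move=> e1 IH1 e2 IH2 d r /andP [w1 w2] leU hr.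
  rewrite IH1 ?IH2 //; try (by lia); by move=> i; have := hr i; lia.
- move=> e1 IH1 e2 IH2 d r /andP [w1 w2] leU hr.
  rewrite IH1 ?IH2 //; try (by lia); by move=> i; have := hr i; lia.
- move=> a e IH b d r w leU hr.
  rewrite IH //; try (by lia); by move=> i; have := hr i; lia.
- move=> i e1 IH1 e2 IH2 d r /andP [w1 w2] leU hr.
  rewrite IH1 ?IH2 ?negb_or ?nw //; try lia.
  + by move=> j; rewrite /upd; case: ifP => // _; have := hr j; lia.
  + by move=> j; have := hr j; lia.
Qed.

Fixpoint cpure (p : cmd) : bool :=
  match p with
  | CWrite _ _ _ => false
  | CSeq p q | CIfLe _ _ p q | CIfArr _ _ _ p q => cpure p && cpure q
  | CFor _ _ p => cpure p
  | _ => true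
  end.

Lemma cpure_av p s : cpure p -> av (csem N p s) = av s.
Proof.
elim: p s => //=.
- by move=> p IHp q IHq s /andP [pp pq]; rewrite IHq // IHp.
- by move=> x y p IHp q IHq s /andP [pp pq]; case: ifP => _; auto.
- by move=> a x b p IHp q IHq s /andP [pp pq]; case: ifP => _; auto.
- move=> c x p IHp s pp; apply: (iteri_inv (P := fun _ s' => av s' = av s)) => //.
  by move=> j s' _ /= e; rewrite IHp.
Qed.

Lemma ecomp_pure d r e : cpure (ecomp d r e).
Proof.
elim: e d r => //=; first (by move=> k d r; elim: k => //= k ->);
  by move=> *; apply/and3P || (apply/andP; split=> //; try apply/andP; auto).
Qed.

Lemma ecomp_av d r e s : av (csem N (ecomp d r e) s) = av s.
Proof. exact: cpure_av (ecomp_pure _ _ _). Qed.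

Lemma ecomp_frame d r e s y : y < d -> cv (csem N (ecomp d r e) s) y = cv s y.
Proof.
by move=> lty; apply: csem_frame; apply/negP=> /ecomp_writes; rewrite leqNgt lty.
Qed.

Lemma csem_for_inc c x d s : d != c -> d != x -> x != c -> cv s d <= N ->
  cv (csem N (CFor c x (CInc d)) s) d = minn (cv s d + cv s x) N.
Proof.
move=> ndc ndx nxc le_d /=.
apply: (iteri_inv (P := fun j s' => cv s' d = minn (cv s d + j) N)).
  by rewrite /= upd_neq //; lia.
by move=> j s' _ e; rewrite /= upd_neq // upd_neq // upd_eq e; lia.
Qed.

Lemma scomp_writes d r p y : swf p -> cwrites (scomp d r p) y -> y < U \/ d <= y.
Proof.
elim: p d r => //=.
- move=> x e d r /andP [ltx _] /orP [/ecomp_writes|/eqP ->]; by [right|left].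
- by move=> a e b d r _ /orP [/ecomp_writes|//]; right.
- by move=> p IHp q IHq d r /andP [wp wq] /orP [/IHp|/IHq]; apply.
- move=> e p IHp q IHq d r /and3P [we wp wq].
  case/or3P=> [/ecomp_writes|/eqP ->|/orP [/IHq|/IHp]]; by [right|right; apply: leqnSn|auto].
- move=> i e p IHp d r /andP [we wp].
  case/orP=> [/ecomp_writes|/or3P [/eqP ->|/eqP ->|/IHp]]; try by right.
  by case=> //; [left | right; lia].
Qed.

Lemma scomp_wf d r p : swf p -> U <= d -> (forall i, r i < d) -> cwf (scomp d r p).
Proof.
elim: p d r => //=.
- by move=> x e d r /andP [ltx we] leU hr; rewrite ecomp_wf //=; lia.
- by move=> a e b d r we leU hr; rewrite ecomp_wf.
- by move=> p IHp q IHq d r /andP [wp wq] leU hr; rewrite IHp ?IHq.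
- by move=> e p IHp q IHq d r /and3P [we wp wq] leU hr; rewrite ecomp_wf ?IHp ?IHq.
- move=> i e p IHp d r /andP [we wp] leU hr; rewrite ecomp_wf //=.
  have hr' k : upd r i d.+1 k < d.+2.
    by rewrite /upd; case: ifP => // _; have := hr k; lia.
  rewrite (IHp _ _ wp _ hr') ?andbT; last by lia.
  apply/and3P; split; first by lia.
    by apply/negP=> /(scomp_writes wp); lia.
  by apply/negP=> /(scomp_writes wp); lia.
Qed.

Hypothesis N_gt0 : 0 < N.

Lemma ecomp_correct d r rho e s : ewf e -> U <= d -> (forall i, r i < d) ->
  (forall i, cv s (r i) = rho i) -> cbounded N s ->
  cv (csem N (ecomp d r e) s) d = eeval N s rho e.
Proof.
elim: e d r rho s.
- move=> k d r rho s _ _ _ _ _ /=.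
  have /= : forall s, cv s d = 0 ->
    cv (csem N (iter k (fun c => CSeq c (CInc d)) CSkip) s) d = minn k N.
    move=> {}s s0; elim: k => [|k IHk] /=; first by rewrite s0; lia.
    by rewrite upd_eq IHk; lia.
  by apply; rewrite /= upd_eq.
- by move=> d r rho s _ _ _ _ _ /=; rewrite upd_eq.
- by move=> x d r rho s _ _ _ _ _ /=; rewrite upd_eq.
- by move=> i d r rho s _ _ _ h _ /=; rewrite upd_eq h.
- move=> e1 IH1 e2 IH2 d r rho s /= /andP [w1 w2] leU hr hrho bs.
  set s1 := csem N (ecomp d r e1) s; set s2 := csem N (ecomp d.+1 r e2) s1.
  have bs1 : cbounded N s1 by apply: csem_bounded.
  have bs2 : cbounded N s2 by apply: csem_bounded.
  rewrite -[iteri _ _ _]/(csem N (CFor d.+2 d.+1 (CInc d)) s2) csem_for_inc //; try lia.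
  rewrite [cv s2 d]ecomp_frame // (IH1 _ _ rho) //; congr (minn (_ + _) N).
  rewrite (IH2 _ _ rho) //; try lia.
  + apply: eeval_agree => //; split=> [x ltx|]; last exact: ecomp_av.
    by apply: ecomp_frame; lia.
  + by move=> i; apply: ltnW; rewrite ltnS; apply: hr.
  + by move=> i; rewrite ecomp_frame.
- move=> e1 IH1 e2 IH2 d r rho s /= /andP [w1 w2] leU hr hrho bs.
  set s1 := csem N (ecomp d.+1 r e1) s; set s2 := csem N (ecomp d.+2 r e2) s1.
  have bs1 : cbounded N s1 by apply: csem_bounded.
  have bs2 : cbounded N s2 by apply: csem_bounded.
  have v1 : cv s2 d.+1 = eeval N s rho e1.
    rewrite ecomp_frame // (IH1 _ _ rho) //; try lia.
    by move=> i; have := hr i; lia.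
  have v2 : cv s2 d.+2 = eeval N s rho e2.
    rewrite (IH2 _ _ rho) //; try lia.
    + apply: eeval_agree => //; split=> [x ltx|]; last exact: ecomp_av.
      by apply: ecomp_frame; lia.
    + by move=> i; have := hr i; lia.
    + by move=> i; rewrite ecomp_frame //; have := hr i; lia.
  rewrite upd_neq; last by lia.
  rewrite v1; set X := eeval N s rho e1; set Y := eeval N s rho e2 in v2 *.
  (* The inner loop consumes its bound, so the second factor is kept in [d.+2] and copied to [d.+4]
     in every round. *)
  pose P j s' := [/\ cv s' d = minn (j * Y) N, cv s' d.+2 = Y & cbounded N s'].
  have: P X (csem N (CFor d.+3 d.+1 (CSeq (CSet d.+4 d.+2) (CFor d.+4.+1 d.+4 (CInc d))))
    (setc s2 d 0)); last by rewrite /= upd_neq ?v1; [case | lia].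
  rewrite /= upd_neq ?v1; last by lia.
  apply: iteri_inv.
    split; try by simp_upd; rewrite ?v2 //; lia.
    by apply: cbounded_setc => //; apply: cbounded_setc.
  move=> j s' ltj [h1 h2 h3].
  rewrite -[iteri _ _ _]/(csem N (CFor d.+4.+1 d.+4 (CInc d)) (setc s' d.+4 (cv s' d.+2))).
  have bs' : cbounded N (setc s' d.+4 (cv s' d.+2)) by apply: cbounded_setc.
  split.
  + simp_upd; rewrite csem_for_inc //; try lia.
    by simp_upd; rewrite h1 h2 mulSn; lia.
  + by simp_upd; rewrite csem_frame /=; [simp_upd | lia].
  + have := bs2 d.+1; rewrite v1 -/X => leX.
    do 2?[apply: cbounded_setc; last lia].
    exact: csem_bounded.
- move=> e1 IH1 e2 IH2 d r rho s /= /andP [w1 w2] leU hr hrho bs.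
  set s1 := csem N (ecomp d.+1 r e1) s; set s2 := csem N (ecomp d.+2 r e2) s1.
  have bs1 : cbounded N s1 by apply: csem_bounded.
  have v1 : cv s2 d.+1 = eeval N s rho e1.
    rewrite ecomp_frame // (IH1 _ _ rho) //; try lia.
    by move=> i; have := hr i; lia.
  have v2 : cv s2 d.+2 = eeval N s rho e2.
    rewrite (IH2 _ _ rho) //; try lia.
    + apply: eeval_agree => //; split=> [x ltx|]; last exact: ecomp_av.
      by apply: ecomp_frame; lia.
    + by move=> i; have := hr i; lia.
    + by move=> i; rewrite ecomp_frame //; have := hr i; lia.
  rewrite upd_neq; last by lia.
  rewrite upd_neq; last by lia.
  by rewrite v1 v2; case: leqP => _ /=; rewrite !upd_eq //; lia.
- move=> a e IH b d r rho s /= w leU hr hrho bs.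
  rewrite upd_neq; last by lia.
  rewrite ecomp_av (IH _ _ rho) //; try lia; last by move=> i; have := hr i; lia.
  by case: eqP => _ /=; rewrite !upd_eq //; lia.
- move=> i e1 IH1 e2 IH2 d r rho s /= /andP [w1 w2] leU hr hrho bs.
  set s1 := csem N (ecomp d.+1 r e1) s.
  have bs1 : cbounded N s1 by apply: csem_bounded.
  have v1 : cv s1 d.+1 = eeval N s rho e1.
    rewrite (IH1 _ _ rho) //; try lia.
    by move=> k; have := hr k; lia.
  rewrite upd_neq; last by lia.
  rewrite v1; set X := eeval N s rho e1.
  have leX : X <= N by rewrite /X -v1.
  pose P j s' := [/\ cv s' d = minn (\sum_(k < j) eeval N s (upd rho i k) e2) N,
    (forall y, y < d -> cv s' y = cv s y), av s' = av s, cv s' d.+2 = j & cbounded N s'].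
  match goal with |- cv ?S d = _ => suff : P X S by case end.
  apply: iteri_inv.
    split.
    + by simp_upd; rewrite big_ord0 min0n.
    + by move=> y lty; simp_upd; apply: ecomp_frame; lia.
    + exact: ecomp_av.
    + by simp_upd.
    + by apply: cbounded_setc => //; apply: cbounded_setc.
  move=> j s' ltj [h1 h2 h3 h4 h5].
  set s3 := csem N (ecomp _ _ _) s'.
  rewrite -[iteri _ _ _]/(csem N (CFor d.+4 d.+3 (CInc d)) s3).
  have bs3 : cbounded N s3 by apply: csem_bounded.
  have v3 : cv s3 d.+3 = eeval N s (upd rho i j) e2.
    rewrite (IH2 _ _ (upd rho i j)) //; try lia.
    + by apply: eeval_agree => //; split=> // x ltx; apply: h2; lia.
    + by move=> k; rewrite /upd; case: ifP => // _; have := hr k; lia.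
    + by move=> k; rewrite /upd; case: ifP => // _; rewrite h2.
  split.
  + simp_upd; rewrite csem_for_inc //; try lia.
    rewrite v3 big_ord_recr /= ecomp_frame; last by lia.
    by rewrite h1; move: (bigop.body _ _ _) (eeval _ _ _ _) => A B; lia.
  + move=> y lty; simp_upd; rewrite csem_frame /=; last by lia.
    by rewrite ecomp_frame ?h2 //; lia.
  + by rewrite -[LHS]/(av (csem N (CFor d.+4 d.+3 (CInc d)) s3)) cpure_av // ecomp_av.
  + by simp_upd.
  + by do 2?[apply: cbounded_setc; last lia]; apply: csem_bounded.
Qed.

(** The registers of bound variables lie between [U] and [d]. Assignments reach only registers below
    [U] and scratch writes only those from [d] on, so bound variables are never overwritten. *)
Lemma scomp_correct d r rho p s s' : swf p -> U <= d ->
  (forall i, U <= r i < d) -> (forall i, cv s' (r i) = rho i) ->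
  cbounded N s' -> agree s s' ->
  agree (ssem N rho p s) (csem N (scomp d r p) s').
Proof.
elim: p d r rho s s' => //.
- move=> x e d r rho s s' /= /andP [ltx we] leU hr hrho bs' [ec ea].
  have hr' i : r i < d by case/andP: (hr i).
  have ve := ecomp_correct we leU hr' hrho bs'; split=> [y lty|] /=; last by rewrite ecomp_av.
  rewrite /upd ve; case: ifP => _; first exact: eeval_agree.
  by rewrite ecomp_frame ?ec //; lia.
- move=> a e b d r rho s s' /= we leU hr hrho bs' [ec ea].
  have hr' i : r i < d by case/andP: (hr i).
  have ve := ecomp_correct we leU hr' hrho bs'; split=> [y lty|] /=.
    by rewrite ecomp_frame ?ec //; lia.
  by rewrite ecomp_av ve ea (@eeval_agree s s' rho rho).
- move=> p IHp q IHq d r rho s s' /= /andP [wp wq] leU hr hrho bs' ag.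
  apply: IHq => //; last exact: IHp.
    move=> i; rewrite csem_frame //; apply/negP=> /(scomp_writes wp).
    by have := hr i; lia.
  exact: csem_bounded.
- move=> e p IHp q IHq d r rho s s' /= /and3P [we wp wq] leU hr hrho bs' ag.
  have hr' i : r i < d by case/andP: (hr i).
  have ve := ecomp_correct we leU hr' hrho bs'.
  rewrite upd_eq upd_neq; last by lia.
  rewrite ve -(@eeval_agree s s' rho rho) // leqn0 lt0n.
  set s2 := setc _ _ _.
  have ag2 : agree s s2.
    case: ag => ec ea; split=> [y lty|] /=; last by rewrite ecomp_av.
    by rewrite upd_neq ?ecomp_frame ?ec //; lia.
  have bs2 : cbounded N s2 by apply: cbounded_setc => //; apply: csem_bounded.
  have hr2 i : cv s2 (r i) = rho i.
    by have := hr' i => lti; rewrite /= upd_neq ?ecomp_frame //; lia.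
  by case: eqP => _; [apply: IHq | apply: IHp].
- move=> i e p IHp d r rho s s' /= /andP [we wp] leU hr hrho bs' ag.
  have hr' k : r k < d by case/andP: (hr k).
  have ve := ecomp_correct we leU hr' hrho bs'.
  rewrite ve -(@eeval_agree s s' rho rho) //; set X := eeval N s rho e.
  have leX : X <= N by rewrite /X (@eeval_agree s s' rho rho) // -ve; apply: csem_bounded.
  set f := fun j s' => setc _ _ _; set s1 := setc _ _ _.
  pose P j s2 := [/\ agree (iteri j (fun j => ssem N (upd rho i j) p) s) s2,
    forall k, cv s2 (r k) = rho k, cv s2 d.+1 = j & cbounded N s2].
  suff : P X (iteri X f s1) by case.
  apply: iteri_inv.
    split; rewrite /= ?upd_eq //.
    + case: ag => ec ea; split=> [y lty|] /=; last by rewrite ecomp_av.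
      by rewrite upd_neq ?ecomp_frame ?ec //; lia.
    + by move=> k; have := hr' k => ltk; rewrite upd_neq ?ecomp_frame //; lia.
    + by apply: cbounded_setc => //; apply: csem_bounded.
  move=> j s2 ltj [ag2 h2 h3 h4].
  have hr2 k : U <= upd r i d.+1 k < d.+2.
    by rewrite /upd; case: ifP => _; [|have := hr k]; lia.
  have hrho2 k : cv s2 (upd r i d.+1 k) = upd rho i j k.
    by rewrite /upd; case: ifP.
  have leU2 : U <= d.+2 by lia.
  have [ec ea] := IHp _ _ _ _ _ wp leU2 hr2 hrho2 h4 ag2.
  split.
  + split=> [y lty|//]; rewrite /= ec // !upd_neq //; lia.
  + move=> k; have := hr k => ltk; rewrite /= upd_neq; last by lia.
    rewrite upd_neq; last by lia.
    by rewrite csem_frame //; apply/negP=> /(scomp_writes wp); lia.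
  + by rewrite /= upd_neq ?upd_eq //; lia.
  + by do 2?[apply: cbounded_setc; last lia]; apply: csem_bounded.
Qed.
End Correctness.

Lemma stmt_polytime (U : nat) (p : stmt) : swf U p -> exists (M : machine) (c d : nat),
  forall w v : seq bool, 0 < size w ->
    (forall j, av (ssem (size w) (fun _ => 0) p (input_store w)) 0 j =
               nth None (map some v) j) ->
    computes_within M (c * size w ^ d + c) w v.
Proof.
(* Register [U] stays 0 and stands for every variable that is not yet bound. *)
move=> wp; have [|M [c [d h]]] := @cmd_polytime (scomp U.+1 (fun _ => U) p).
  exact: (scomp_wf (U := U)).
exists M, c, d => w v w_gt0 hv; apply: h => // j; rewrite -hv.
set s := input_store w; have [_ ->] // : agree U (ssem (size w) (fun _ => 0) p s)
  (csem (size w) (scomp U.+1 (fun _ => U) p) s).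
by apply: (scomp_correct w_gt0) => // _; rewrite leqnn ltnSn.
Qed.

(** * The program *)

(* Variables: 0 is the number of vertices, 1 the parameter, 2 a power of two, *)
(* 3 the length of the output. Arrays: 0 is the input, whose adjacency matrix *)
(* is updated in place, 1 marks the vertices that have not been contracted    *)
(* away, 2 is the side of a potential bridge, 3 is the output.                *)
Notation eand := EMul.
Definition enot e := ELe e (ECst 0).
Definition eeq e1 e2 := eand (ELe e1 e2) (ELe e2 e1).
Definition esucc e := EAdd e (ECst 1).
Definition ecell e1 e2 := EAdd (esucc (EVar 0)) (EAdd (EMul e1 (EVar 0)) e2).
Definition emat e1 e2 := EArr 0 (ecell e1 e2) (Some true).
Definition ealive e := EArr 1 e (Some true).
Definition eside e := EArr 2 e (Some true).
Definition ecard (a : nat) := ESum 3 (EVar 0) (EArr a (EBnd 3) (Some true)).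

Definition side_init : stmt :=
  SFor 3 (EVar 0) (SIf (eeq (EBnd 3) (EBnd 1))
    (SWrite 2 (EBnd 3) (Some true)) (SWrite 2 (EBnd 3) (Some false))).

Definition side_row : stmt :=
  SFor 4 (EVar 0)
    (SIf (eand (eside (EBnd 3)) (eand (ealive (EBnd 4)) (eand (emat (EBnd 3) (EBnd 4))
           (enot (eand (eeq (EBnd 3) (EBnd 1)) (eeq (EBnd 4) (EBnd 2)))))))
         (SWrite 2 (EBnd 4) (Some true)) SSkip).

Definition side_round : stmt := SFor 3 (EVar 0) side_row.

Definition side_loop : stmt := SFor 5 (EVar 0) side_round.

Definition ebridge : expr :=
  eand (enot (eside (EBnd 2)))
    (eand (ELe (EAdd (EVar 1) (ECst 2)) (ecard 2))
          (ELe (EAdd (EAdd (EVar 1) (ECst 2)) (ecard 2)) (ecard 1))).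

Definition merge_rows : stmt :=
  SFor 3 (EVar 0) (SIf (eand (emat (EBnd 2) (EBnd 3)) (enot (eeq (EBnd 3) (EBnd 1))))
    (SSeq (SWrite 0 (ecell (EBnd 1) (EBnd 3)) (Some true))
          (SWrite 0 (ecell (EBnd 3) (EBnd 1)) (Some true))) SSkip).

(** The new vertex keeps the index of the first end. The row and column of the second end are not
    erased; array 1 masks them from now on. *)
Definition merge_edge : stmt := SSeq merge_rows (SWrite 1 (EBnd 2) (Some false)).

Definition try_edge : stmt :=
  SIf (eand (ealive (EBnd 1)) (eand (ealive (EBnd 2)) (emat (EBnd 1) (EBnd 2))))
    (SSeq side_init (SSeq side_loop (SIf ebridge merge_edge SSkip))) SSkip.

Definition reduce_pass : stmt := SFor 1 (EVar 0) (SFor 2 (EVar 0) try_edge).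

Definition reduce : stmt := SFor 0 (EVar 0) reduce_pass.

Lemma ssem_if N rho e p q s : ssem N rho (SIf e p q) s =
  if 0 < eeval N s rho e then ssem N rho p s else ssem N rho q s.
Proof. by []. Qed.

Lemma ssem_seq N rho p q s : ssem N rho (SSeq p q) s = ssem N rho q (ssem N rho p s).
Proof. by []. Qed.

Lemma ssem_write N rho a e b s : ssem N rho (SWrite a e b) s = seta s a (eeval N s rho e) b.
Proof. by []. Qed.

Lemma ssem_for N rho i e p s X : eeval N s rho e = X ->
  ssem N rho (SFor i e p) s = iteri X (fun j => ssem N (upd rho i j) p) s.
Proof. by move=> <-. Qed.

Lemma ssem_for_var N rho i x p s X : cv s x = X ->
  ssem N rho (SFor i (EVar x) p) s = iteri X (fun j => ssem N (upd rho i j) p) s.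
Proof. by move=> <-. Qed.

Section Reduction.
Variables (n N : nat).
Definition cell (i j : nat) : nat := n.+1 + (i * n + j).

Definition mat (s : store) i j : bool := av s 0 (cell i j) == Some true.

Definition mark (s : store) a i : bool := av s a i == Some true.

Lemma cell_lt i j : i < n -> j < n -> cell i j < n.+1 + n * n.
Proof.
move=> lti ltj; rewrite /cell ltn_add2l.
by have : i.+1 * n <= n * n by [rewrite leq_mul2r lti orbT]; rewrite mulSn; lia.
Qed.

Lemma cell_inj i j i' j' : j < n -> j' < n ->
  (cell i j == cell i' j') = (i == i') && (j == j').
Proof.
move=> ltj ltj'; rewrite /cell eqn_add2l; apply/eqP/andP => [e|[/eqP -> /eqP ->]] //.
have ei : i = i'.
  by have := congr1 (divn^~ n) e; rewrite !divnMDl ?divn_small ?addn0 //; lia.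
by split; apply/eqP=> //; move: e; rewrite ei => /addnI.
Qed.

(** Under this bound neither a matrix index nor a vertex count saturates. *)
Hypothesis leN : n.+1 + n * n <= N.

Section Eval.
Variables (s : store) (rho : nat -> nat).
Lemma eeval_and e1 e2 (b1 b2 : bool) : eeval N s rho e1 = b1 ->
  eeval N s rho e2 = b2 -> eeval N s rho (eand e1 e2) = b1 && b2.
Proof. by move=> /= -> ->; rewrite mulnb; case: (b1 && b2); lia. Qed.

Lemma eeval_not e (b : bool) : eeval N s rho e = b -> eeval N s rho (enot e) = ~~ b.
Proof. by move=> /= ->; case: b; rewrite ?min0n. Qed.

Lemma eeval_eq e1 e2 : eeval N s rho (eeq e1 e2) = (eeval N s rho e1 == eeval N s rho e2).
Proof.
by rewrite (@eeval_and _ _ (eeval N s rho e1 <= eeval N s rho e2)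
  (eeval N s rho e2 <= eeval N s rho e1)) // -eqn_leq.
Qed.

Hypothesis s0 : cv s 0 = n.

Lemma eeval_cell e1 e2 i j : eeval N s rho e1 = i -> eeval N s rho e2 = j ->
  i < n -> j < n -> eeval N s rho (ecell e1 e2) = cell i j.
Proof.
move=> /= -> -> lti ltj; rewrite s0; have := cell_lt lti ltj; rewrite /cell.
by move: (i * n) (n * n) leN => a b; lia.
Qed.

Lemma eeval_mat e1 e2 i j : eeval N s rho e1 = i -> eeval N s rho e2 = j ->
  i < n -> j < n -> eeval N s rho (emat e1 e2) = mat s i j.
Proof. by move=> e1i e2j lti ltj; rewrite /mat -(eeval_cell e1i e2j). Qed.

Lemma eeval_ecard a : eeval N s rho (ecard a) = \sum_(i < n) mark s a i.
Proof.
rewrite /= s0; apply/minn_idPl/leq_trans/(leq_trans _ leN)/leq_addr.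
apply: leqW; rewrite -[X in _ <= X]muln1 -[n in _ <= n * _]card_ord -sum_nat_const.
by apply: leq_sum => i _; apply: leq_b1.
Qed.
End Eval.

Definition same_but (a0 : nat) (s s' : store) : Prop :=
  cv s' = cv s /\ forall a, a != a0 -> av s' a = av s a.

Lemma same_but_trans a s1 s2 s3 : same_but a s1 s2 -> same_but a s2 s3 -> same_but a s1 s3.
Proof. by move=> [c1 a1] [c2 a2]; split=> [|b nb]; [rewrite c2 | rewrite a2 ?a1]. Qed.

Lemma same_but_seta a s i b : same_but a s (seta s a i b).
Proof. by split=> // c nc; rewrite /= upd_neq. Qed.

Lemma mark_seta s a i b j : mark (seta s a i b) a j =
  if j == i then b == Some true else mark s a j.
Proof. by rewrite /mark /= upd_eq /upd; case: ifP. Qed.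

Section Side.
Variables (u v : nat).

Definition side_rel (s : store) i j : bool :=
  [&& mark s 1 j, mat s i j & ~~ ((i == u) && (j == v))].

Lemma side_rel_same s s' i j : same_but 2 s s' -> side_rel s' i j = side_rel s i j.
Proof. by move=> [_ h]; rewrite /side_rel /mark /mat !h. Qed.

(* One step of the closure under [side_rel] from the pairs in [D]; the closed  *)
(* sets [S] bound the result from above.                                      *)
Definition side_step (D : nat -> nat -> bool) (S : pred nat) (s s' : store) : Prop :=
  [/\ same_but 2 s s', forall i, mark s 2 i -> mark s' 2 i,
      forall i j, D i j -> j < n -> mark s 2 i -> side_rel s i j -> mark s' 2 j &
      (forall i, i < n -> mark s 2 i -> S i) -> forall i, i < n -> mark s' 2 i -> S i].

(** Marks are read while they are being set, so the exact effect of a round depends on the order of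
    the scan. Hence only two bounds are stated: marks present at the start propagate, and no mark
    leaves a closed set. *)
Lemma side_row_correct (S : pred nat) s rho : cv s 0 = n -> rho 1 = u -> rho 2 = v -> rho 3 < n ->
  (forall i j, i < n -> j < n -> S i -> side_rel s i j -> S j) ->
  side_step (fun i j => i == rho 3) S s (ssem N rho side_row s).
Proof.
move=> s0 r1 r2 lt3 clS.
suff : side_step (fun i j => (i == rho 3) && (j < n)) S s (ssem N rho side_row s).
  by case=> h1 h2 h3 h4; split=> // i j di ltj; apply: h3; rewrite ?di ?ltj.
rewrite /side_row (ssem_for_var _ _ _ _ s0).
apply: (iteri_inv (P := fun t => side_step (fun i j => (i == rho 3) && (j < t)) S s)).
  by split=> // i j; rewrite andbF.
move=> t s' ltt [same mono prog sound].
have s'0 : cv s' 0 = n by case: same => ->.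
pose c := mark s' 2 (rho 3) && side_rel s (rho 3) t.
rewrite ssem_if.
have -> : eeval N s' (upd rho 4 t) (eand (eside (EBnd 3)) (eand (ealive (EBnd 4))
    (eand (emat (EBnd 3) (EBnd 4))
       (enot (eand (eeq (EBnd 3) (EBnd 1)) (eeq (EBnd 4) (EBnd 2))))))) = c.
  rewrite /c -(side_rel_same _ _ same); apply: eeval_and => //; apply: eeval_and => //.
  apply: eeval_and; first by apply: eeval_mat.
  apply: eeval_not; rewrite -r1 -r2; apply: eeval_and; exact: eeval_eq.
rewrite lt0b; case: ifP => hc; last first.
  split=> // i j /andP [/eqP ei]; rewrite ltnS leq_eqVlt => /orP [/eqP ej|ltjt] ltj si sij.
    by move: hc; rewrite /c -ei -ej sij mono.
  by apply: (prog i) => //; rewrite ei eqxx.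
rewrite ssem_write; have -> : eeval N s' (upd rho 4 t) (EBnd 4) = t by [].
split.
- exact: same_but_trans same (same_but_seta _ _ _ _).
- by move=> i /mono si; rewrite mark_seta; case: ifP.
- move=> i j /andP [/eqP ei]; rewrite ltnS leq_eqVlt => /orP [/eqP ej|ltjt] ltj si sij;
    rewrite mark_seta; first by rewrite ej eqxx.
  by case: ifP => // _; apply: (prog i) => //; rewrite ei eqxx.
- move=> hS i lti; rewrite mark_seta; case: eqP => [-> _|_]; last exact: sound.
  case/andP: hc => s3 rel; apply: clS rel => //; exact: sound.
Qed.

Lemma side_round_correct (S : pred nat) s rho : cv s 0 = n -> rho 1 = u -> rho 2 = v ->
  (forall i j, i < n -> j < n -> S i -> side_rel s i j -> S j) ->
  side_step (fun i j => i < n) S s (ssem N rho side_round s).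
Proof.
move=> s0 r1 r2 clS; rewrite /side_round (ssem_for_var _ _ _ _ s0).
apply: (iteri_inv (P := fun t => side_step (fun i j => i < t) S s)) => //.
move=> t s' ltt [same mono prog sound].
have s'0 : cv s' 0 = n by case: same => ->.
have [|||||same2 mono2 prog2 sound2] := @side_row_correct S s' (upd rho 3 t) => //.
  by move=> i j lti ltj; rewrite (side_rel_same _ _ same); apply: clS.
split.
- exact: same_but_trans same same2.
- by move=> i /mono /mono2.
- move=> i j; rewrite ltnS leq_eqVlt => /orP [/eqP ei|lti] ltj si sij.
    by apply: (prog2 i) => //; [rewrite ei | apply: mono | rewrite (side_rel_same _ _ same)].
  by apply: mono2; apply: (prog i).
- by move=> /sound; exact: sound2.
Qed.

End Side.
End Reduction.

(** * Graphs in memory *)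

Lemma eeval_le N s rho e1 e2 :
  eeval N s rho (ELe e1 e2) = (eeval N s rho e1 <= eeval N s rho e2).
Proof. by []. Qed.

Lemma eeval_add N s rho e1 e2 :
  eeval N s rho (EAdd e1 e2) = minn (eeval N s rho e1 + eeval N s rho e2) N.
Proof. by []. Qed.

Section Representation.
Variables (n K N : nat).
Hypothesis leN : n.+1 + n * n <= N.

(** The current graph is an iterated [contract], whose vertex type changes with every merge; [phi]
    ties it to the fixed index set. Matrix entries outside the image of [phi] are left
    unconstrained. *)
Definition stores_graph (H : sgraph) (phi : H -> 'I_n) (s : store) : Prop :=
  [/\ injective phi, forall i : 'I_n, mark s 1 i = (i \in codom phi) &
      forall x y, mat n s (phi x) (phi y) = sedge x y].

Lemma stores_graph_same (H : sgraph) (phi : H -> 'I_n) s s' :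
  same_but 2 s s' -> stores_graph phi s -> stores_graph phi s'.
Proof.
move=> [_ e] [inj al ed]; split=> // [i|x y]; first by rewrite -al /mark e.
by rewrite -ed /mat e.
Qed.

Lemma stores_graph_card (H : sgraph) (phi : H -> 'I_n) s : stores_graph phi s -> #|H| <= n.
Proof. by case=> inj _ _; rewrite -[X in _ <= X]card_ord; apply: leq_card inj. Qed.

Lemma sum_mem_image (H : finType) (phi : H -> 'I_n) (S : {set H}) (b : nat -> bool) :
  injective phi -> (forall i : 'I_n, b i = (i \in phi @: S)) -> \sum_(i < n) b i = #|S|.
Proof.
move=> inj hb; rewrite -(card_imset _ inj) -sum1_card [RHS]big_mkcond.
by apply: eq_bigr => i _; rewrite hb; case: (i \in _).
Qed.

Lemma side_init_correct s rho : cv s 0 = n ->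
  same_but 2 s (ssem N rho side_init s) /\
  forall i, i < n -> mark (ssem N rho side_init s) 2 i = (i == rho 1).
Proof.
move=> s0; rewrite /side_init (ssem_for_var _ _ _ _ s0).
apply: (iteri_inv (P := fun t s' => same_but 2 s s' /\
  forall i, i < t -> mark s' 2 i = (i == rho 1))) => //.
move=> t s' ltt [same hs'].
rewrite ssem_if (eeval_eq leN) !ssem_write lt0b [eeval _ _ _ (EBnd 3)]/= upd_eq.
have -> : eeval N s' (upd rho 3 t) (EBnd 1) = rho 1 by [].
case: ifP => et; (split; [exact: same_but_trans same (same_but_seta _ _ _ _)|]);
  move=> i; rewrite ltnS leq_eqVlt => /orP [/eqP ->|lti]; rewrite mark_seta;
  by rewrite ?eqxx ?et ?(ltn_eqF lti) ?hs'.
Qed.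

(** After [t] rounds every vertex at the end of a path of length at most [t] is marked. Paths can be
    taken simple, so [n] rounds suffice; conversely the near side is closed under the relation. *)
Lemma side_correct (H : sgraph) (phi : H -> 'I_n) s x y (rho : nat -> nat) :
  stores_graph phi s -> cv s 0 = n -> rho 1 = phi x -> rho 2 = phi y ->
  let s' := ssem N rho (SSeq side_init side_loop) s in
  same_but 2 s s' /\ forall i : 'I_n, mark s' 2 i = (i \in phi @: near_side x y).
Proof.
move=> rep s0 r1 r2 s'; have [inj al ed] := rep.
have [same1 init1] := @side_init_correct s rho s0.
rewrite /s' ssem_seq; set s1 := ssem N rho side_init s in same1 init1 *.
have s10 : cv s1 0 = n by case: same1 => ->.
pose er z w := sedge z w && ~~ ((z == x) && (w == y)).
have relE z w : side_rel n (phi x) (phi y) s (phi z) (phi w) = er z w.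
  rewrite /side_rel al codom_f ed /= /er.
  by rewrite !(inj_eq (@ord_inj n)) !(inj_eq inj).
pose S i := [exists z in near_side x y, phi z == i :> nat].
have clS i j : i < n -> j < n -> S i -> side_rel n (phi x) (phi y) s i j -> S j.
  move=> lti ltj /exists_inP [z zN /eqP ez] rel.
  have : mark s 1 (Ordinal ltj) by case/and3P: rel.
  rewrite al => /codomP [w ew]; have ew' : j = phi w by rewrite -ew.
  rewrite ew' -ez relE in rel.
  apply/exists_inP; exists w; last by rewrite ew'.
  by move: zN; rewrite !inE => zN; apply: connect_trans zN (connect1 rel).
rewrite /side_loop (ssem_for_var _ _ _ _ s10).
pose P t s2 := [/\ same_but 2 s s2, (forall i, i < n -> mark s2 2 i -> S i) &
  forall p, size p <= t -> path er x p -> mark s2 2 (phi (last x p))].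
have [same2 sound complete] : P n (iteri n (fun j => ssem N (upd rho 5 j) side_round) s1).
  apply: iteri_inv.
    split=> // [i lti|[|//] _ _]; last by rewrite init1 //= r1.
    rewrite init1 // r1 => /eqP ->; apply/exists_inP; exists x => //.
    by rewrite inE connect0.
  move=> t s2 ltt [same2 sound complete].
  have s20 : cv s2 0 = n by case: same2 => ->.
  have [||||same3 mono prog sound3] :=
    @side_round_correct n N leN (phi x) (phi y) S s2 (upd rho 5 t) => //.
    by move=> i j lti ltj; rewrite (side_rel_same _ _ _ _ _ same2); apply: clS.
  split; first exact: same_but_trans same2 same3.
    exact: sound3.
  move=> p; case/lastP: p => [_ _|p z]; first by apply: mono; apply: (complete [::]).
  rewrite size_rcons last_rcons rcons_path ltnS => sp /andP [pp ez].
  apply: (prog (phi (last x p))) => //; first exact: complete.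
  by rewrite (side_rel_same _ _ _ _ _ same2) relE.
split=> // i; apply/idP/imsetP => [/(sound _ (ltn_ord i))|[z]].
  by case/exists_inP=> z zN /eqP ez; exists z => //; apply: ord_inj.
rewrite inE => /connectP [p pp ->] ->.
case/shortenP: pp => p' pp' up' _; apply: complete => //.
apply: leq_trans (stores_graph_card rep).
by have := max_card (mem (x :: p')); rewrite (card_uniqP up') => /ltnW.
Qed.

(** Saturation is harmless: the cardinalities on the right are at most [n < N], so a left-hand side
    that reaches [N] makes the comparison false, as does its true value. *)
Lemma ebridge_correct (H : sgraph) (phi : H -> 'I_n) s x y (rho : nat -> nat) :
  stores_graph phi s -> cv s 0 = n -> cv s 1 = minn K N -> rho 2 = phi y -> sedge x y ->
  (forall i : 'I_n, mark s 2 i = (i \in phi @: near_side x y)) ->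
  eeval N s rho ebridge = reducible_edge K x y.
Proof.
move=> rep s0 s1 r2 exy hs; have [inj al ed] := rep.
have cardH := stores_graph_card rep.
have c2 : \sum_(i < n) mark s 2 i = #|near_side x y| by apply: sum_mem_image hs.
have c1 : \sum_(i < n) mark s 1 i = #|H|.
  rewrite -cardsT; apply: (sum_mem_image inj) => i; rewrite al.
  by apply/codomP/imsetP => [[z ->]|[z _ ->]]; exists z.
have cardN : #|near_side x y| <= #|H| by apply: max_card.
rewrite /reducible_edge exy andTb; apply: (eeval_and leN).
  apply: eeval_not; rewrite /= r2 -/(mark s 2 _) hs.
  by rewrite mem_imset.
apply: (eeval_and leN).
  rewrite eeval_le eeval_add (eeval_ecard leN) // c2 /= s1; congr nat_of_bool.
  by lia.
rewrite eeval_le !eeval_add !(eeval_ecard leN) // c1 c2 /= s1; congr nat_of_bool.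
by move: cardN cardH leN; move: (n * n) #|near_side x y| #|H| => a b c; lia.
Qed.

Lemma av_seta_eq s a i b j : av (seta s a i b) a j = if j == i then b else av s a j.
Proof. by rewrite /= upd_eq. Qed.

Lemma mat_seta s i j i' j' : j < n -> j' < n ->
  mat n (seta s 0 (cell n i j) (Some true)) i' j' = mat n s i' j' || (i' == i) && (j' == j).
Proof.
by move=> ltj ltj'; rewrite /mat av_seta_eq cell_inj //; case: ifP; rewrite ?orbT ?orbF.
Qed.

(* The digits of k are stored behind the matrix and must survive the reduction. *)
Definition same_tail (s s' : store) : Prop :=
  [/\ cv s' = cv s, av s' 3 = av s 3 & forall j, n.+1 + n * n <= j -> av s' 0 j = av s 0 j].

Lemma same_tail_trans s1 s2 s3 : same_tail s1 s2 -> same_tail s2 s3 -> same_tail s1 s3.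
Proof.
by move=> [a1 b1 c1] [a2 b2 c2]; split=> [||j h]; [rewrite a2|rewrite b2|rewrite c2 ?c1].
Qed.

Lemma same_but_tail s s' : same_but 2 s s' -> same_tail s s'.
Proof. by move=> [e1 e2]; split=> // [|j _]; rewrite e2. Qed.

Lemma same_tail_cell s i j b : i < n -> j < n -> same_tail s (seta s 0 (cell n i j) b).
Proof.
move=> lti ltj; split=> // l hl; rewrite av_seta_eq gtn_eqF //.
exact: leq_trans (cell_lt lti ltj) hl.
Qed.

Lemma merge_rows_correct s rho (u v : nat) : cv s 0 = n -> rho 1 = u -> rho 2 = v ->
  u < n -> v < n -> u != v -> ~~ mat n s v v ->
  let s' := ssem N rho merge_rows s in
  [/\ same_tail s s', av s' 1 = av s 1 &
      forall i j, i < n -> j < n -> mat n s' i j =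
        [|| mat n s i j, [&& i == u, mat n s v j & j != u] |
            [&& j == u, mat n s v i & i != u]]].
Proof.
move=> s0 r1 r2 ltu ltv nuv nvv s'; rewrite {}/s' /merge_rows (ssem_for_var _ _ _ _ s0).
pose P t s' := [/\ same_tail s s', av s' 1 = av s 1 &
  forall i j, i < n -> j < n -> mat n s' i j =
        [|| mat n s i j, [&& i == u, j < t, mat n s v j & j != u] |
            [&& j == u, i < t, mat n s v i & i != u]]].
have [same al hm] : P n (iteri n (fun j => ssem N (upd rho 3 j) (SIf (eand (emat (EBnd 2) (EBnd 3))
   (enot (eeq (EBnd 3) (EBnd 1))))
    (SSeq (SWrite 0 (ecell (EBnd 1) (EBnd 3)) (Some true))
          (SWrite 0 (ecell (EBnd 3) (EBnd 1)) (Some true))) SSkip)) s).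
  apply: iteri_inv.
    by split=> // i j lti ltj; rewrite !ltn0 !andbF !orbF.
  move=> t s' ltt [same al hm]; have s'0 : cv s' 0 = n by case: same => ->.
  rewrite ssem_if (@eeval_and n N leN _ _ _ _ (mat n s' v t) (t != u)); last 2 first.
  - by apply: (eeval_mat leN); rewrite //= /upd /=.
  - by apply: eeval_not; rewrite (eeval_eq leN) -r1.
  (* The row of [v] can be read during the update: its only cell that a round might write is the one
     at [u], in round [v], and that would require a loop at [v]. *)
  have -> : mat n s' v t && (t != u) = mat n s v t && (t != u).
    by rewrite hm // (negbTE nvv) [v == u]eq_sym (negbTE nuv) /= !andbF orbF.
  rewrite lt0b.
  have ltS l : (l < t.+1) = (l == t) || (l < t) by rewrite ltnS leq_eqVlt.
  case: ifP => [/andP [mvt ntu]|hc]; last first.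
    split=> // i j lti ltj; rewrite hm //; congr (_ || (_ || _)).
      by rewrite ltS; case: (eqVneq j t) => [->|] //=; rewrite ltnn hc.
    by rewrite ltS; case: (eqVneq i t) => [->|] //=; rewrite ltnn hc.
  rewrite ssem_seq !ssem_write (@eeval_cell n N leN s' _ s'0 _ _ u t) //.
  set s2 := seta s' _ _ _.
  rewrite (@eeval_cell n N leN s2 _ s'0 _ _ t u) //.
  split.
  - apply: same_tail_trans same _; apply: (same_tail_trans (s2 := s2));
      exact: same_tail_cell.
  - by rewrite /= !upd_neq.
  - move=> i j lti ltj; rewrite !mat_seta // hm // !ltS.
    case: (eqVneq i u) => [->|niu]; case: (eqVneq j u) => [->|nju];
      rewrite ?andbF ?orbF ?andbT /= ?[u == t]eq_sym ?(negbTE ntu) ?orbF //=.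
    + by case: (eqVneq j t) => [->|njt]; rewrite /= ?mvt ?orbT ?orbF.
    + by case: (eqVneq i t) => [->|nit]; rewrite /= ?mvt ?orbT ?orbF.
split=> // i j lti ltj; rewrite hm //; by rewrite lti ltj.
Qed.

Definition contract_phi (H : sgraph) (phi : H -> 'I_n) (x y : H) (z : contract x y) : 'I_n :=
  if z is Some w then phi (val w) else phi x.

Lemma merge_edge_correct (H : sgraph) (phi : H -> 'I_n) s x y (rho : nat -> nat) :
  stores_graph phi s -> cv s 0 = n -> rho 1 = phi x -> rho 2 = phi y -> sedge x y ->
  let s' := ssem N rho merge_edge s in
  same_tail s s' /\ stores_graph (@contract_phi H phi x y) s'.
Proof.
move=> [inj al ed] s0 r1 r2 exy s'; rewrite /s' /merge_edge ssem_seq ssem_write.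
have phi_neq z w : z != w -> (phi z != phi w :> nat).
  by move=> nzw; rewrite (inj_eq (@ord_inj n)) (inj_eq inj).
have nxy : x != y by apply/eqP/sedge_neq.
have [|||||||same al1 hm] := @merge_rows_correct s rho (phi x) (phi y) => //.
- exact: phi_neq.
- by rewrite ed sedge_irr.
set s1 := ssem N rho merge_rows s in same al1 hm *.
rewrite [eeval _ _ _ _]r2; split.
  by apply: same_tail_trans same _; split.
split.
- move=> [w|] [w'|] //= /inj e.
  + by congr Some; apply: val_inj.
  + by case/andP: (valP w) => /=; rewrite e eqxx.
  + by case/andP: (valP w') => /=; rewrite -e eqxx.
- move=> i; rewrite mark_seta /mark al1 -/(mark s 1 i) al.
  case: (eqVneq (i : nat) (phi y)) => [/ord_inj ->|niy].
    apply/esym/negbTE/codomP => -[[w|]] /= /inj e.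
      by case/andP: (valP w) => /=; rewrite -e eqxx.
    by rewrite e eqxx in nxy.
  apply/codomP/codomP => [[z ez]|[[w|] ->]]; last 2 first.
  + by exists (val w).
  + by exists x.
  have [ezx|nzx] := eqVneq z x; first by exists None; rewrite ez ezx.
  have nzy : z != y by apply: contraNneq niy => <-; rewrite ez.
  have pz : (z != x) && (z != y) by rewrite nzx.
  by exists (Some (Sub z pz)); rewrite ez.
- have matE i j : mat n (seta s1 1 (phi y) (Some false)) i j = mat n s1 i j by [].
  move=> [w|] [w'|]; rewrite matE hm //= !ed.
  + case/andP: (valP w) => nwx _; case/andP: (valP w') => nwx' _.
    by rewrite !(negbTE (phi_neq _ _ _)) //= !orbF.
  + case/andP: (valP w) => nwx _.
    rewrite !(negbTE (phi_neq _ _ nwx)) eqxx /= andbT.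
    by rewrite [sedge (val w) x]sedge_sym.
  + case/andP: (valP w') => nwx' _.
    by rewrite !(negbTE (phi_neq _ _ nwx')) eqxx /= andbT orbF.
  + by rewrite eqxx !andbF sedge_irr.
Qed.

End Representation.

(** * Exhaustive reduction *)

Section Passes.
Variables (n K N : nat) (G : sgraph) (s0 : store).
Hypotheses (leN : n.+1 + n * n <= N) (s00 : cv s0 0 = n) (s01 : cv s0 1 = minn K N).

Definition stores_equivalent (s : store) (H : sgraph) (phi : H -> 'I_n) : Prop :=
  [/\ same_tail n s0 s, stores_graph phi s,
      contractible_to_path K G <-> contractible_to_path K H &
      connected_graph G -> connected_graph H].

Definition irreducible (H : sgraph) : Prop := forall x y : H, ~~ reducible_edge K x y.

Lemma stores_equivalent_cv s (H : sgraph) (phi : H -> 'I_n) :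
  stores_equivalent s phi -> cv s 0 = n /\ cv s 1 = minn K N.
Proof. by case=> -[-> _ _]. Qed.

Lemma stores_equivalent_same s s' (H : sgraph) (phi : H -> 'I_n) : same_but 2 s s' ->
  stores_equivalent s phi -> stores_equivalent s' phi.
Proof.
move=> e [t g y c]; split=> //; last exact: stores_graph_same g.
exact: same_tail_trans t (same_but_tail _ e).
Qed.

Lemma try_edge_correct s (H : sgraph) (phi : H -> 'I_n) (rho : nat -> nat) :
  rho 1 < n -> rho 2 < n -> stores_equivalent s phi ->
  let s' := ssem N rho try_edge s in
  (stores_equivalent s' phi /\
     forall x y, phi x = rho 1 :> nat -> phi y = rho 2 :> nat -> ~~ reducible_edge K x y) \/
  (exists x y : H, reducible_edge K x y /\
     stores_equivalent s' (@contract_phi n H phi x y)).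
Proof.
move=> lt1 lt2 eqv s'; rewrite {}/s' /try_edge ssem_if.
have [cv0 cv1] := stores_equivalent_cv eqv.
have [tl gr yes conn] := eqv; have [inj al ed] := gr.
rewrite (@eeval_and n N leN _ _ _ _ (mark s 1 (rho 1))
    (mark s 1 (rho 2) && mat n s (rho 1) (rho 2))) //;
  last by apply: (eeval_and leN) => //; apply: (eeval_mat leN).
rewrite lt0b; case: ifP => [/and3P [a1 a2 m12]|nedge]; last first.
  left; split=> // x y ex ey; move: nedge; rewrite -ex -ey !al !codom_f ed /=.
  by rewrite /reducible_edge => ->.
have [x ex] : exists x, phi x = rho 1 :> nat.
  by move: a1; rewrite -[rho 1]/(val (Ordinal lt1)) al => /codomP [x ->]; exists x.
have [y ey] : exists y, phi y = rho 2 :> nat.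
  by move: a2; rewrite -[rho 2]/(val (Ordinal lt2)) al => /codomP [y ->]; exists y.
have exy : sedge x y by rewrite -ed ex ey.
have [same side] := @side_correct n N leN H phi s x y rho gr cv0 (esym ex) (esym ey).
have -> : ssem N rho (SSeq side_init (SSeq side_loop (SIf ebridge merge_edge SSkip))) s =
  ssem N rho (SIf ebridge merge_edge SSkip) (ssem N rho (SSeq side_init side_loop) s) by [].
set s1 := ssem N rho (SSeq side_init side_loop) s in same side *.
have eqv1 := stores_equivalent_same same eqv.
have [cv10 cv11] := stores_equivalent_cv eqv1.
have [tl1 gr1 _ _] := eqv1.
rewrite ssem_if (ebridge_correct leN gr1 cv10 cv11 (esym ey) exy side) lt0b.
case: ifP => red; last first.
  left; split=> // x' y' ex' ey'; rewrite -ex in ex'; rewrite -ey in ey'.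
  by move/ord_inj/inj: ex' => ->; move/ord_inj/inj: ey' => ->; rewrite red.
right; exists x, y; split=> //.
have [tl2 gr2] := merge_edge_correct leN gr1 cv10 (esym ex) (esym ey) exy.
split=> //; first exact: same_tail_trans tl1 tl2.
  exact: iff_trans yes (reducible_edge_safe red).
by move/conn; apply: contraction_map_connected (contract_proj_map exy).
Qed.

(** The first component lets [reduce_correct] rule out that the graph was irreducible before the
    pass. *)
Definition stores_smaller (H : sgraph) (s : store) : Prop :=
  ~ irreducible H /\ exists (H' : sgraph) (phi' : H' -> 'I_n),
    stores_equivalent s phi' /\ #|H'| < #|H|.

Lemma card_contract_lt (H : sgraph) (x y : H) :
  reducible_edge K x y -> #|contract x y| < #|H|.
Proof. by case/andP=> exy _; rewrite (card_contract exy). Qed.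

(** A pass without a merge has tested every pair against the same graph. After a merge only
    equivalence and the smaller size are maintained; earlier pairs are left to the next pass. *)
Lemma reduce_pass_correct s (H : sgraph) (phi : H -> 'I_n) (rho : nat -> nat) :
  stores_equivalent s phi ->
  let s' := ssem N rho reduce_pass s in
  (stores_equivalent s' phi /\ irreducible H) \/ stores_smaller H s'.
Proof.
move=> eqv s'; rewrite {}/s'.
have try_smaller s' rho' : rho' 1 < n -> rho' 2 < n -> stores_smaller H s' ->
    stores_smaller H (ssem N rho' try_edge s').
  move=> lt1 lt2 [nirr [H' [phi' [eqv' ltH']]]]; split=> //.
  have [[e _]|[x [y [red e]]]] := try_edge_correct lt1 lt2 eqv'.
    by exists H', phi'.
  exists (contract x y), (@contract_phi n H' phi' x y); split=> //.
  exact: ltn_trans (card_contract_lt red) ltH'.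
pose P t s' := (stores_equivalent s' phi /\
  forall x y, phi x < t -> ~~ reducible_edge K x y) \/ stores_smaller H s'.
suff [[e irr]|] : P n (ssem N rho reduce_pass s).
- by left; split=> // x y; apply: irr.
- by right.
have [cv0 _] := stores_equivalent_cv eqv.
rewrite /reduce_pass (ssem_for_var _ _ _ _ cv0).
apply: iteri_inv; first by left.
move=> u s1 ltu P1.
have cv10 : cv s1 0 = n.
  by case: P1 => [[/stores_equivalent_cv [] //]|[_ [H' [phi' [/stores_equivalent_cv []]]]]].
rewrite (ssem_for_var _ _ _ _ cv10).
pose Q t s' := (stores_equivalent s' phi /\
  forall x y, phi x < u \/ phi x = u :> nat /\ phi y < t -> ~~ reducible_edge K x y) \/
  stores_smaller H s'.
have : Q n (iteri n (fun j => ssem N (upd (upd rho 1 u) 2 j) try_edge) s1).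
  apply: iteri_inv.
    case: P1 => [[e irr]|]; last by right.
    by left; split=> // x y [|[_ //]]; apply: irr.
  move=> v s2 ltv [[e irr]|sm]; last by right; apply: try_smaller.
  have [||[e' irr']|[x [y [red e']]]] :=
    @try_edge_correct s2 H phi (upd (upd rho 1 u) 2 v) _ _ e => //.
    left; split=> // x y h; have [eyv|nyv] := eqVneq (phi y : nat) v; last first.
      apply: irr; case: h => [|[h1 h2]]; [by left | right; split=> //].
      by move: h2; rewrite ltnS leq_eqVlt (negbTE nyv).
    by case: h => [h|[h _]]; [apply: irr; left | apply: irr'].
  right; split; first by move/(_ x y); rewrite red.
  by exists (contract x y), (@contract_phi n H phi x y); split=> //; apply: card_contract_lt.
case=> [[e irr]|]; last by right.
left; split=> // x y; rewrite ltnS leq_eqVlt => /orP [/eqP h|h]; apply: irr; last by left.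
by right.
Qed.

(** Every pass that does not find the graph irreducible removes a vertex. After [n] passes the graph
    is irreducible or has no vertices at all, and then it is irreducible vacuously. *)
Lemma reduce_correct s (phi : G -> 'I_n) (rho : nat -> nat) :
  #|G| <= n -> stores_equivalent s phi ->
  exists (H : sgraph) (psi : H -> 'I_n),
    stores_equivalent (ssem N rho reduce s) psi /\ irreducible H.
Proof.
move=> leGn eqv; have [cv0 _] := stores_equivalent_cv eqv.
pose P t s' := exists (H : sgraph) (psi : H -> 'I_n),
  stores_equivalent s' psi /\ (irreducible H \/ #|H| + t <= n).
have : P n (ssem N rho reduce s).
  rewrite /reduce (ssem_for_var _ _ _ _ cv0); apply: iteri_inv.
    by exists G, phi; split=> //; right; rewrite addn0.
  move=> t s' ltt [H [psi [e h]]].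
  have [[e' irr]|[nirr [H' [psi' [e' ltH']]]]] := reduce_pass_correct (upd rho 0 t) e.
    by exists H, psi; split=> //; left.
  exists H', psi'; split=> //; case: h => // leH; right.
  by rewrite addnS; apply: leq_trans leH; rewrite -addSn leq_add2r.
case=> H [psi [e [irr|leH]]]; first by exists H, psi.
exists H, psi; split=> // x; have /card0_eq/(_ x) : #|H| = 0 by lia.
by rewrite inE.
Qed.

End Passes.

(** * Reading the instance *)

Definition ebits : expr := EAdd (esucc (EVar 0)) (EMul (EVar 0) (EVar 0)).

(** Counts the positions [i] such that the cells 0 to [i] all hold 1. As the input starts with [n]
    ones and a zero, these are the positions below [n]. *)
Definition parse_size : stmt :=
  SAssign 0 (ESum 0 EMax (ELe (esucc (EBnd 0))
    (ESum 1 (esucc (EBnd 0)) (EArr 0 (EBnd 1) (Some true))))).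

(** Register 2 holds the current power of two. Doubling and adding both saturate at [N], which
    yields the minimum of [k] and [N]. *)
Definition parse_param : stmt :=
  SSeq (SAssign 2 (ECst 1))
    (SFor 0 EMax (SIf (ELe ebits (EBnd 0))
      (SSeq (SIf (EArr 0 (EBnd 0) (Some true)) (SAssign 1 (EAdd (EVar 1) (EVar 2))) SSkip)
            (SAssign 2 (EAdd (EVar 2) (EVar 2)))) SSkip)).

Definition init_alive : stmt := SFor 0 (EVar 0) (SWrite 1 (EBnd 0) (Some true)).

Definition bits_val (l : seq bool) : nat := foldr (fun (b : bool) m => b + m.*2) 0 l.

Lemma bits_val_of_nat m : bits_val (bits_of_nat m) = m.
Proof.
rewrite -[RHS]bin_of_natK /bits_of_nat; case: (bin_of_nat m) => //= p.
elim: p => //= p ->; [|by rewrite add0n NatTrec.doubleE].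
by rewrite add1n NatTrec.doubleE.
Qed.

Lemma bits_val_take l j : j < size l ->
  bits_val (take j.+1 l) = bits_val (take j l) + nth false l j * 2 ^ j.
Proof.
elim: l j => // b l IHl [|j] ltj; first by rewrite take0 /= take0 expn0; case: (b).
rewrite -[LHS]/(b + (bits_val (take j.+1 l)).*2) -[X in _ = X + _]/(b + (bits_val (take j l)).*2).
by rewrite IHl // expnS /=; lia.
Qed.

Lemma nth_allpairs_iota (F : nat -> nat -> bool) n m i j : i < m -> j < n ->
  nth false [seq F a b | a <- iota 0 m, b <- iota 0 n] (i * n + j) = F i j.
Proof.
move=> lti ltj; have : forall c, nth false [seq F a b | a <- iota c m, b <- iota 0 n]
  (i * n + j) = F (c + i) j; last by move=> ->.
elim: m i lti => // m IHm [|i] lti c /=; rewrite nth_cat size_map size_iota.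
  by rewrite mul0n add0n ltj (nth_map 0) ?size_iota // nth_iota // addn0.
rewrite mulSn -addnA ltnNge leq_addr addKn IHm //.
by rewrite addSnnS.
Qed.

Section Input.
Variable I : instance.
Let n := nverts I.
Let K := param I.
Let w := encode I.
Let N := size w.
Let bits := bits_of_nat K.

Definition adj_nat (i j : nat) : bool :=
  if (insub i : option 'I_n, insub j : option 'I_n) is (Some i', Some j')
  then adj i' j' else false.

Lemma adj_natE (i j : 'I_n) : adj_nat i j = adj i j.
Proof. by rewrite /adj_nat !valK. Qed.

Lemma encodeE :
  w = nseq n true ++ false :: [seq adj_nat i j | i <- iota 0 n, j <- iota 0 n] ++ bits.
Proof.
rewrite /w /encode; congr (_ ++ _ :: _ ++ _).
rewrite -val_enum_ord allpairs_mapl allpairs_mapr.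
by apply: eq_allpairs => i j; rewrite adj_natE.
Qed.

Lemma size_input : N = n.+1 + n * n + size bits.
Proof.
by rewrite /N encodeE size_cat /= size_cat size_nseq size_allpairs !size_iota addnS addSn addnA.
Qed.

Lemma le_input : n.+1 + n * n <= N.
Proof. by rewrite size_input leq_addr. Qed.

Lemma input_size_bits j : j < N -> j < n -> nth None (map some w) j = Some true.
Proof.
by move=> ltN ltn; rewrite (nth_map false) // encodeE nth_cat size_nseq ltn nth_nseq ltn.
Qed.

Lemma input_sep : nth None (map some w) n = Some false.
Proof.
rewrite (nth_map false); last by rewrite -/N size_input -addnA leq_addr.
by rewrite encodeE nth_cat size_nseq ltnn subnn.
Qed.

Lemma input_cell (i j : 'I_n) : nth None (map some w) (cell n i j) = Some (adj i j).
Proof.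
have ltc := cell_lt (ltn_ord i) (ltn_ord j).
rewrite (nth_map false); last exact: leq_trans ltc le_input.
rewrite encodeE nth_cat size_nseq /cell addSn -addnS ltnNge leq_addr addKn /= nth_cat.
rewrite size_allpairs !size_iota -(ltn_add2l n.+1) -/(cell n i j) ltc.
by rewrite nth_allpairs_iota // adj_natE.
Qed.

Lemma input_bits j : n.+1 + n * n <= j -> j < N ->
  nth None (map some w) j = Some (nth false bits (j - (n.+1 + n * n))).
Proof.
move=> lej ltj; rewrite (nth_map false) // encodeE nth_cat size_nseq.
have -> : j < n = false by lia.
have -> : j - n = (j - n.+1).+1 by lia.
rewrite /= nth_cat size_allpairs !size_iota.
have -> : j - n.+1 < n * n = false by lia.
by rewrite subnDA.
Qed.

Lemma leq_sum_bool (f : nat -> bool) m : (m <= \sum_(j < m) f j) = all f (iota 0 m).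
Proof.
have le l : \sum_(j < l) f j <= l.
  elim: l => [|l IHl]; first by rewrite big_ord0.
  by rewrite big_ord_recr /= -addn1 leq_add ?leq_b1.
elim: m => [|m IHm]; first by rewrite big_ord0.
have -> : iota 0 m.+1 = rcons (iota 0 m) m by rewrite -addn1 iotaD cats1.
rewrite big_ord_recr /= all_rcons -IHm andbC.
case: (f m); rewrite /= ?addn1 ?addn0 ?ltnS ?andbT ?andbF //.
by apply/negbTE; rewrite -leqNgt; apply: le.
Qed.

Lemma sum_lt m l : l <= m -> \sum_(i < m) (i < l) = l.
Proof.
elim: m => [|m IHm]; first by rewrite leqn0 big_ord0 => /eqP.
rewrite big_ord_recr /= leq_eqVlt => /orP [/eqP ->|ltl].
  rewrite ltnSn addn1; congr _.+1.
  rewrite -[RHS]muln1 -[m in RHS]card_ord -sum_nat_const; apply: eq_bigr => i _.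
  by rewrite ltnS ltnW.
by rewrite IHm // ltnNge -ltnS ltl addn0.
Qed.

Lemma parse_size_correct rho :
  let s := ssem N rho parse_size (input_store w) in
  [/\ cv s 0 = n, forall x, x != 0 -> cv s x = 0 & av s = av (input_store w)].
Proof.
split=> //; last by move=> x nx /=; rewrite upd_neq.
rewrite [LHS]/= upd_eq -/N -/(input_store w).
have leN := le_input; have nN : n <= N by apply: leq_trans leN; rewrite addSn -addnS leq_addr.
rewrite (eq_bigr (fun i : 'I_N => (i < n : nat))) ?sum_lt //; first exact/minn_idPl.
move=> i _; have lti := ltn_ord i.
have -> : minn (upd rho 0 (nat_of_ord i) 0 + minn 1 N) N = i.+1 by rewrite upd_eq; lia.
pose f j := nth None (map some w) j == Some true.
rewrite (eq_bigr (fun j : 'I_i.+1 => f j : nat)) //.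
have -> : (i.+1 <= minn (\sum_(j < i.+1) f j) N) = (i.+1 <= \sum_(j < i.+1) f j).
  by rewrite leq_min lti andbT.
rewrite leq_sum_bool; congr nat_of_bool; apply/allP/idP => [h|ltn j].
  rewrite ltnNge; apply/negP=> lein.
  have := h n; rewrite mem_iota /= add0n ltnS lein => /(_ isT).
  by rewrite /f input_sep.
rewrite mem_iota /= add0n ltnS => lej; apply/eqP.
apply: input_size_bits; last exact: leq_ltn_trans ltn.
exact: leq_ltn_trans lti.
Qed.

Lemma eeval_bits s rho : cv s 0 = n -> eeval N s rho ebits = n.+1 + n * n.
Proof.
move=> s0; rewrite /= s0; have := le_input; move: (n * n) => a; lia.
Qed.

Lemma parse_param_correct s rho : cv s 0 = n -> cv s 1 = 0 -> cv s 3 = 0 ->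
  av s = av (input_store w) ->
  let s' := ssem N rho parse_param s in
  [/\ cv s' 0 = n, cv s' 1 = minn K N, cv s' 3 = 0 & av s' = av (input_store w)].
Proof.
move=> s0 s1 s3 sa s'.
pose b0 := n.+1 + n * n; have leN := le_input.
(* Truncated subtraction keeps the invariant constant until the digits of the parameter begin at
   [b0]. *)
pose P t s2 := [/\ cv s2 0 = n, cv s2 1 = minn (bits_val (take (t - b0) bits)) N,
  cv s2 2 = minn (2 ^ (t - b0)) N, cv s2 3 = 0 & av s2 = av (input_store w)].
suff : P N s'.
  case=> h0 h1 _ h3 ha; split=> //; rewrite h1; congr minn.
  by rewrite take_oversize ?bits_val_of_nat // size_input /b0; lia.
rewrite {}/s' /parse_param ssem_seq (@ssem_for _ _ _ EMax _ _ N) //.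
apply: iteri_inv.
  by split=> //=; rewrite ?upd_neq ?s1 ?take0 ?min0n.
move=> t s2 ltt [h0 h1 h2 h3 ha].
rewrite ssem_if eeval_le eeval_bits // -[_ + _]/b0 lt0b.
have -> : eeval N s2 (upd rho 0 t) (EBnd 0) = t by [].
case: (leqP b0 t) => hbt; last first.
  have e : t.+1 - b0 = t - b0 by move: hbt; rewrite /b0; move: (n * n) => a; lia.
  by rewrite /P e.
have bit : eeval N s2 (upd rho 0 t) (EArr 0 (EBnd 0) (Some true)) = nth false bits (t - b0).
  by rewrite /= ha /= upd_eq input_bits //; case: (nth _ _ _).
have e : t.+1 - b0 = (t - b0).+1 by move: hbt; rewrite /b0; move: (n * n) => a; lia.
have ltb : t - b0 < size bits by move: ltt hbt; rewrite size_input /b0; move: (n * n) => a; lia.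
rewrite ssem_seq ssem_if bit /P e bits_val_take // expnS.
move: (2 ^ (t - b0)) (bits_val _) h1 h2 => pw k h1 h2.
by case: (nth false bits (t - b0)); split; rewrite /= /upd /= ?h1 ?h2 //; lia.
Qed.

Lemma init_alive_correct s rho : cv s 0 = n -> cv s 1 = minn K N -> cv s 3 = 0 ->
  av s = av (input_store w) ->
  let s' := ssem N rho init_alive s in
  [/\ cv s' = cv s, forall a, a != 1 -> av s' a = av (input_store w) a &
      forall i, i < n -> mark s' 1 i].
Proof.
move=> s0 s1 s3 sa s'; rewrite {}/s' /init_alive (ssem_for_var _ _ _ _ s0).
apply: (iteri_inv (P := fun t s2 => [/\ cv s2 = cv s,
  forall a, a != 1 -> av s2 a = av (input_store w) a & forall i, i < t -> mark s2 1 i])).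
  by split=> // a _; rewrite sa.
move=> t s2 ltt [hc ha hm]; rewrite ssem_write; split=> //.
  by move=> a na; rewrite /= upd_neq // ha.
move=> i; rewrite mark_seta [eeval _ _ _ _]upd_eq ltnS leq_eqVlt.
by case: eqP => //= _; apply: hm.
Qed.

Lemma stores_input s : (forall a, a != 1 -> av s a = av (input_store w) a) ->
  (forall i, i < n -> mark s 1 i) -> stores_graph (fun x : graph_of I => x : 'I_n) s.
Proof.
move=> ha hm; split=> // [i|x y]; first by rewrite hm // (codom_f (fun x : 'I_n => x)).
by rewrite /mat ha // /= input_cell; case: (adj x y).
Qed.

End Input.

(** * Writing the output *)

Definition append_bit (b : bool) : stmt :=
  SSeq (SWrite 3 (EVar 3) (Some b)) (SAssign 3 (esucc (EVar 3))).

Definition append_value (e : expr) : stmt := SIf e (append_bit true) (append_bit false).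

Definition write_graph : stmt :=
  SSeq (SFor 0 (ecard 1) (append_bit true))
 (SSeq (append_bit false)
 (SSeq (SFor 0 (EVar 0) (SFor 1 (EVar 0)
          (SIf (eand (ealive (EBnd 0)) (ealive (EBnd 1)))
               (append_value (emat (EBnd 0) (EBnd 1))) SSkip)))
       (SFor 0 EMax (SIf (ELe ebits (EBnd 0))
          (append_value (EArr 0 (EBnd 0) (Some true))) SSkip)))).

Definition write_word (l : seq bool) : stmt :=
  foldr (fun b p => SSeq (append_bit b) p) SSkip l.

(** The output is collected in array 3 because array 0 is still being read meanwhile. Blanks are
    copied as well, which erases the rest of the input. *)
Definition copy_output : stmt :=
  SFor 0 EMax (SIf (EArr 3 (EBnd 0) (Some true)) (SWrite 0 (EBnd 0) (Some true))
    (SIf (EArr 3 (EBnd 0) (Some false)) (SWrite 0 (EBnd 0) (Some false))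
                                        (SWrite 0 (EBnd 0) None))).

Section Output.
Variable N : nat.

Definition same_input (s s' : store) : Prop :=
  (forall x, x != 3 -> cv s' x = cv s x) /\ (forall a, a != 3 -> av s' a = av s a).

Definition has_output (s : store) (l : seq bool) : Prop :=
  cv s 3 = size l /\ forall j, av s 3 j = nth None (map some l) j.

(** Quantifying over the word [l0] already written and over all stores that agree with [s] outside
    the output makes this property compositional. The length bound is there because the output
    length is held in a saturating register. *)
Definition emits (rho : nat -> nat) (p : stmt) (s : store) (l : seq bool) : Prop :=
  forall l0 s', same_input s s' -> has_output s' l0 -> size l0 + size l <= N ->
  same_input s (ssem N rho p s') /\ has_output (ssem N rho p s') (l0 ++ l).

Lemma emits_skip rho s : emits rho SSkip s [::].
Proof. by move=> l0 s' ss' ho _; rewrite cats0. Qed.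

Lemma emits_bit rho s b : emits rho (append_bit b) s [:: b].
Proof.
move=> l0 s' [ec ea] [o1 o2]; rewrite /= addn1 => ltN; split.
  by split=> [x nx|a na] /=; rewrite upd_neq ?ec ?ea.
split=> /= [|j]; first by rewrite upd_eq o1 size_cat /= addn1; lia.
rewrite upd_eq /upd o1 map_cat nth_cat size_map.
case: (ltngtP j (size l0)) => [ltj|gtj|->]; first by rewrite o2.
  by rewrite o2 !nth_default ?size_map //=; lia.
by rewrite subnn.
Qed.

Lemma emits_seq rho p q s l1 l2 : emits rho p s l1 -> emits rho q s l2 ->
  emits rho (SSeq p q) s (l1 ++ l2).
Proof.
move=> h1 h2 l0 s' ss' ho; rewrite size_cat addnA => le; rewrite ssem_seq catA.
have [|s1 o1] := h1 _ _ ss' ho; first by apply: leq_trans le; rewrite leq_addr.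
by apply: h2; rewrite ?size_cat.
Qed.

Lemma emits_if rho e p q s (b : bool) l1 l2 :
  (forall s', same_input s s' -> eeval N s' rho e = b) ->
  (b -> emits rho p s l1) -> emits rho q s l2 -> emits rho (SIf e p q) s (if b then l1 else l2).
Proof.
move=> he h1 h2 l0 s' ss' ho le; rewrite ssem_if he // lt0b.
by case: b {he} h1 le => h1 le; [apply: h1 | apply: h2].
Qed.

Lemma emits_value rho e s (b : bool) :
  (forall s', same_input s s' -> eeval N s' rho e = b) ->
  emits rho (append_value e) s [:: b].
Proof.
move=> he; have -> : [:: b] = if b then [:: true] else [:: false] by case: (b).
by apply: emits_if => // *; apply: emits_bit.
Qed.

Lemma emits_for rho i e p s X (f : nat -> seq bool) :
  (forall s', same_input s s' -> eeval N s' rho e = X) ->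
  (forall j, j < X -> emits (upd rho i j) p s (f j)) ->
  emits rho (SFor i e p) s (flatten (mkseq f X)).
Proof.
move=> he hp l0 s' ss' ho le; rewrite (ssem_for _ _ (he _ ss')).
apply: (iteri_inv (P := fun t s2 => same_input s s2 /\
  has_output s2 (l0 ++ flatten (mkseq f t)))); first by rewrite cats0.
move=> t s2 ltt [ss2 ho2].
have mk : mkseq f t.+1 = rcons (mkseq f t) (f t) by rewrite /mkseq -addn1 iotaD map_cat cats1.
rewrite mk flatten_rcons catA; apply: hp => //.
have {}le : size (l0 ++ flatten (mkseq f t.+1)) <= N.
  apply: leq_trans le; rewrite size_cat leq_add2l -(subnKC ltt) [mkseq f (_ + _)]/mkseq iotaD.
  by rewrite map_cat flatten_cat size_cat leq_addr.
by rewrite -size_cat -catA -flatten_rcons -mk.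
Qed.

Lemma emits_word rho s l : emits rho (write_word l) s l.
Proof.
elim: l => [|b l IHl]; first exact: emits_skip.
by rewrite -cat1s; apply: (emits_seq (p := append_bit b)) => //; apply: emits_bit.
Qed.

Lemma copy_output_correct s rho l : has_output s l -> size l <= N ->
  (forall j, N <= j -> av s 0 j = None) ->
  forall j, av (ssem N rho copy_output s) 0 j = nth None (map some l) j.
Proof.
move=> [_ ho] leN s0; rewrite /copy_output (@ssem_for _ _ _ EMax _ _ N) //.
pose P t s' := av s' 3 = av s 3 /\ forall j,
  av s' 0 j = if j < t then nth None (map some l) j else av s 0 j.
set f := fun j => _.
have [_ h] : P N (iteri N f s).
  apply: iteri_inv => // t s' ltt [e3 e0].
  have cur b : eeval N s' (upd rho 0 t) (EArr 3 (EBnd 0) b) = (nth None (map some l) t == b).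
    by rewrite /= upd_eq e3 ho.
  have -> : f t s' = seta s' 0 t (nth None (map some l) t).
    rewrite /f !ssem_if !cur !ssem_write [eeval _ _ _ (EBnd 0)]upd_eq.
    by case: (nth None _ t) => [[]|].
  split=> [|j]; first by rewrite /= upd_neq.
  rewrite av_seta_eq e0 [j < t.+1]ltnS [j <= t]leq_eqVlt.
  by case: eqP => [->|] //.
move=> j; rewrite h; case: ltnP => // leNj.
by rewrite s0 // nth_default // size_map; apply: leq_trans leNj.
Qed.

End Output.

Lemma flatten_if_filter (T : Type) (P : pred nat) (g : nat -> seq T) r :
  flatten [seq (if P i then g i else [::]) | i <- r] = flatten [seq g i | i <- r & P i].
Proof. by elim: r => //= i r ->; case: (P i). Qed.

Section GraphOutput.
Variables (n K N : nat) (bits : seq bool).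
Hypothesis (sizeN : N = n.+1 + n * n + size bits).

Lemma write_graph_emits (H : sgraph) (phi : H -> 'I_n) s rho :
  stores_graph phi s -> cv s 0 = n ->
  (forall j, n.+1 + n * n <= j -> j < N ->
     av s 0 j = Some (nth false bits (j - (n.+1 + n * n)))) ->
  let D := [seq i <- iota 0 n | mark s 1 i] in
  emits N rho write_graph s
    (nseq #|H| true ++ false :: [seq mat n s i j | i <- D, j <- D] ++ bits).
Proof.
move=> gr s0 hb D; have [inj al ed] := gr.
have leN : n.+1 + n * n <= N by rewrite sizeN leq_addr.
have s'0 s' : same_input s s' -> cv s' 0 = n by move=> [-> //].
have mark1 s' i : same_input s s' -> mark s' 1 i = mark s 1 i.
  by move=> [_ e]; rewrite /mark e.
have mat0 s' i j : same_input s s' -> mat n s' i j = mat n s i j.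
  by move=> [_ e]; rewrite /mat e.
apply: emits_seq.
  have -> : nseq #|H| true = flatten (mkseq (fun _ => [:: true]) #|H|).
    rewrite /mkseq; move: (iota _ _) (size_iota 0 #|H|) => r <-.
    by elim: r => //= _ r ->.
  apply: emits_for => [s' ss'|j _]; last exact: emits_bit.
  rewrite (eeval_ecard leN) ?s'0 // -cardsT; apply: (sum_mem_image inj) => i.
  rewrite mark1 // al.
  by apply/codomP/imsetP => [[z ->]|[z _ ->]]; exists z.
rewrite -cat1s; apply: emits_seq; first exact: emits_bit.
apply: emits_seq.
  have -> : [seq mat n s i j | i <- D, j <- D] = flatten (mkseq (fun i =>
      flatten (mkseq (fun j => if mark s 1 i && mark s 1 j then [:: mat n s i j] else [::]) n)) n).
    rewrite /D -flatten_if_filter /mkseq; congr flatten; apply: eq_map => i.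
    case: (mark s 1 i) => /=; last by elim: (iota 0 n).
    by rewrite flatten_if_filter; elim: (filter _ _) => //= j r ->.
  apply: emits_for => [s' ss'|i lti]; first exact: s'0.
  apply: emits_for => [s' ss'|j ltj]; first exact: s'0.
  apply: emits_if => [s' ss'|_|]; last exact: emits_skip.
    by apply: (eeval_and leN); rewrite -(mark1 s').
  apply: emits_value => s' ss'; rewrite -(mat0 s') //.
  by apply: (eeval_mat leN) => //; apply: s'0.
have -> : bits = flatten (mkseq (fun j => if n.+1 + n * n <= j
    then [:: nth false bits (j - (n.+1 + n * n))] else [::]) N).
  rewrite flatten_if_filter sizeN iotaD filter_cat add0n.
  rewrite (@eq_in_filter _ _ pred0) ?filter_pred0; last first.
    by move=> i; rewrite mem_iota add0n /= => lti; apply/negbTE; rewrite -ltnNge.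
  rewrite (@eq_in_filter _ _ predT) ?filter_predT; last first.
    by move=> i; rewrite mem_iota => /andP [].
  rewrite -[in iota _ _](addn0 (_ + _)) iotaDl -map_comp.
  rewrite (@eq_map _ _ _ (fun i => [:: nth false bits i])); last first.
    by move=> i /=; rewrite addKn.
  rewrite -[LHS](mkseq_nth false) /mkseq.
  by elim: (iota _ _) => //= i r ->.
apply: emits_for => [//|j ltj].
apply: emits_if => [s' ss'|lej|]; last exact: emits_skip.
  rewrite eeval_le [eeval _ _ _ (EBnd 0)]upd_eq /= s'0 //.
  by congr (nat_of_bool (_ <= _)); move: leN; move: (n * n) => a; lia.
apply: emits_value => s' [_ ea]; rewrite /= ea // upd_eq hb //.
by case: (nth _ _ _).
Qed.
End GraphOutput.

(** * The kernel *)

(** The header 1110, the rows 011, 101 and 110, and the empty string for the parameter 0. *)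
Definition triangle_word : seq bool :=
  [:: true; true; true; false; false; true; true; true; false; true; true; true; false].

Lemma encode_triangle : encode triangle_instance = triangle_word.
Proof.
pose F (i j : nat) := i != j.
have e : [seq triangle_adj i j | i <- enum 'I_3, j <- enum 'I_3] =
    [seq F i j | i <- iota 0 3, j <- iota 0 3].
  by rewrite -val_enum_ord allpairs_mapl allpairs_mapr; apply: eq_allpairs.
by rewrite /encode /= e.
Qed.

Lemma map_enum_val (T : finType) (A : {pred T}) : [seq enum_val i | i <- enum 'I_#|A|] = enum A.
Proof.
case: (pickP A) => [x0 Ax0|A0]; last first.
  have A00 : #|A| = 0 by apply: eq_card0.
  have : size (enum A) = 0 by rewrite -cardE.
  move/size0nil ->; apply: size0nil; rewrite size_map size_enum_ord.
  exact: A00.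
apply: (@eq_from_nth _ x0); first by rewrite size_map size_enum_ord cardE.
move=> i; rewrite size_map size_enum_ord => lti.
rewrite (nth_map (Ordinal lti)) ?size_enum_ord // (enum_val_nth x0).
by rewrite nth_enum_ord.
Qed.

Lemma stored_instance n (H : sgraph) (phi : H -> 'I_n) s K : stores_graph phi s ->
  let D := [seq i <- iota 0 n | mark s 1 i] in
  exists I : instance, [/\ param I = K, isomorphic (graph_of I) H &
    encode I = nseq #|H| true ++ false :: [seq mat n s i j | i <- D, j <- D] ++ bits_of_nat K].
Proof.
move=> [inj al ed] D.
(* The remaining vertices are renumbered in increasing order of their indices, the order in which
   the output loops visit them. *)
pose psi (i : 'I_#|codom phi|) : H := iinv (enum_valP i).
have phi_psi i : phi (psi i) = enum_val i by apply: f_iinv.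
have psi_inj : injective psi.
  by move=> i j e; apply: enum_val_inj; rewrite -!phi_psi e.
pose a i j := sedge (psi i) (psi j).
have a_sym : symmetric a by move=> i j; apply: sedge_sym.
have a_irr : irreflexive a by move=> i; apply: sedge_irr.
exists (Instance a_sym a_irr K); split=> //.
  exists psi => //; apply: inj_card_bij => //=.
  by rewrite card_ord card_codom.
rewrite /encode /= -{1}(card_codom inj); congr (_ ++ _ :: _ ++ _).
have DE : D = [seq val (enum_val i) | i <- enum 'I_#|codom phi|].
  rewrite (map_comp val) map_enum_val /D -val_enum_ord filter_map; congr map.
  rewrite {2}/enum_mem -enumT; apply: eq_filter => i /=; exact: al.
rewrite DE allpairs_mapl allpairs_mapr; apply: eq_allpairs => i j.
by rewrite /a -ed !phi_psi.
Qed.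

(** The value saturates at [N], which exceeds every vertex count, so comparing a vertex count with
    it is exact. *)
Definition esize_bound : expr :=
  let k := EVar 1 in EAdd k (EAdd k (EAdd k (EAdd k (EAdd k (ECst 3))))).

Definition write_result : stmt :=
  SIf (ELe (ecard 1) esize_bound) write_graph (write_word triangle_word).

Definition kernel_stmt : stmt :=
  SSeq parse_size (SSeq parse_param (SSeq init_alive
    (SSeq reduce (SSeq write_result copy_output)))).

Lemma kernel_stmt_correct (I : instance) : exists I' : instance,
  [/\ #|graph_of I'| <= 5 * param I + 3, yes_instance I <-> yes_instance I',
      connected_graph (graph_of I) -> connected_graph (graph_of I') &
      forall j, av (ssem (size (encode I)) (fun _ => 0) kernel_stmt
                      (input_store (encode I))) 0 j = nth None (map some (encode I')) j].
Proof.
set w := encode I; set N := size w; set n := nverts I; set K := param I.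
have leN : n.+1 + n * n <= N := le_input I.
have sizeN : N = n.+1 + n * n + size (bits_of_nat K) := size_input I.
pose rho0 (_ : nat) := 0; rewrite -/rho0.
have [p0 pz pa] := parse_size_correct I rho0.
rewrite /kernel_stmt ssem_seq; set s1 := ssem _ _ parse_size _ in p0 pz pa *.
have [q0 q1 q3 qa] := parse_param_correct rho0 p0 (pz 1 isT) (pz 3 isT) pa.
rewrite ssem_seq; set s2 := ssem _ _ parse_param _ in q0 q1 q3 qa *.
have [rc ra rm] := init_alive_correct rho0 q0 q1 q3 qa.
rewrite ssem_seq; set s3 := ssem _ _ init_alive _ in rc ra rm *.
have gr3 := stores_input ra rm.
have c30 : cv s3 0 = n by rewrite rc.
have c31 : cv s3 1 = minn K N by rewrite rc.
have eqv3 : stores_equivalent K (graph_of I) s3 s3 (fun x : graph_of I => x : 'I_n) by split.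
have cardG : #|graph_of I| <= n by rewrite card_ord.
have [H [psi [eqv4 irr]]] := reduce_correct leN c30 c31 rho0 cardG eqv3.
rewrite ssem_seq; set s4 := ssem _ _ reduce _ in eqv4 *.
have [cv40 cv41] := stores_equivalent_cv c30 c31 eqv4.
have [[c4 a43 a40] gr4 yesH connH] := eqv4.
have cardH := stores_graph_card gr4; have [inj4 al4 _] := gr4.
have ss4 : same_input s4 s4 by [].
have out4 : has_output s4 [::].
  by split=> [|j]; [rewrite c4 rc | rewrite a43 ra //= nth_nil].
have tail4 j : n.+1 + n * n <= j -> av s4 0 j = nth None (map some w) j.
  by move=> lej; rewrite a40 // ra.
have blank4 j : N <= j -> av s4 0 j = None.
  by move=> leNj; rewrite tail4 ?(leq_trans leN) // nth_default // size_map.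
have finish p (I' : instance) : emits N rho0 p s4 (encode I') -> size (encode I') <= N ->
    forall j, av (ssem N rho0 copy_output (ssem N rho0 p s4)) 0 j =
      nth None (map some (encode I')) j.
  move=> em leI'; have [[_ ea] ho] := em _ _ ss4 out4 leI'.
  by apply: copy_output_correct => // j leNj; rewrite ea // blank4.
rewrite ssem_seq /write_result ssem_if.
have -> : eeval N s4 rho0 (ELe (ecard 1) esize_bound) = (#|H| <= 5 * K + 3).
  rewrite eeval_le (eeval_ecard leN) // (@sum_mem_image n H psi setT) //; last first.
    move=> i; rewrite al4.
    by apply/codomP/imsetP => [[z ->]|[z _ ->]]; exists z.
  rewrite cardsT /esize_bound /= cv41; congr nat_of_bool.
  by move: cardH leN; move: (n * n) #|H| => a c; lia.
rewrite lt0b; case: leqP => [leH|gtH].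
  have [I' [pI' isoI' encI']] := stored_instance K gr4.
  have cardI' : #|graph_of I'| = #|H| by case: isoI' => f /bij_eq_card.
  exists I'; split.
  - by rewrite cardI'.
  - rewrite /yes_instance pI'; apply: iff_trans yesH _.
    by apply: iff_sym; apply: isomorphic_contractible_to_path.
  - by move/connH; apply: isomorphic_connected; apply: isomorphic_sym.
  - apply: finish.
      rewrite encI'; apply: (write_graph_emits sizeN rho0 gr4 cv40) => j lej ltj.
      by rewrite tail4 // input_bits.
    have nI' : nverts I' = #|H| by rewrite -cardI' card_ord.
    (* The output fits because it has no more vertices than the input and the same digits of the
       parameter. *)
    rewrite size_input nI' pI' sizeN leq_add2r leq_add //.
    by rewrite leq_mul.
exists triangle_instance; split.
- by rewrite card_ord; apply: leq_addl.
- split=> [/yesH yH|/triangle_no //]; have := irreducible_card yH irr.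
  by rewrite leqNgt gtH.
- by move=> _; apply: triangle_connected.
- apply: finish; rewrite encode_triangle; first exact: emits_word.
  (* The 13 symbols of the triangle must fit into the length of the input. The reduced graph has
     more than 3 vertices here, so the input has at least [5 + 16] symbols. *)
  have n4 : 4 <= n by apply: leq_trans cardH; apply: leq_trans gtH; lia.
  have : 4 * 4 <= n * n by apply: leq_mul.
  by move=> h; apply: leq_trans leN => /=; lia.
Qed.

Theorem theorem1 :
  exists kernel : instance -> instance,
    polytime encode encode kernel /\
    forall I : instance,
      [/\ #|graph_of (kernel I)| <= 5 * param I + 3,
          yes_instance I <-> yes_instance (kernel I) &
          connected_graph (graph_of I) -> connected_graph (graph_of (kernel I))].
Proof.
(* For each instance the output instance is only known to exist, being recovered from the final
   memory. Choice makes it a function, and the machine computes it because the program fixes the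
   encoding of the chosen instance. *)
have [kernel hk] := functional_choice _ kernel_stmt_correct.
exists kernel; split; last by move=> I; have [] := hk I.
have [|M [c [d hM]]] := @stmt_polytime 4 kernel_stmt; first by [].
exists M, c, d => I; have [_ _ _ h] := hk I.
by apply: hM => //; rewrite size_cat addnS.
Qed.
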